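(* Let $X$ be a compact connected manifold and let $f : X \to X$ be an Anosov diffeomorphism. For $\varepsilon>0$ let $f_\varepsilon : X \to 2^X$ be the set-valued map $f_\varepsilon(x) = B_\varepsilon(f(x))$. If $f_\varepsilon$ is transitive for every $\varepsilon > 0$, then $f$ is transitive.
   Context: $X$ is a smooth manifold with the distance induced by a Riemannian metric; $B_\varepsilon(y)$ is the open ball of radius $\varepsilon$ centered at $y$; $2^X$ is the collection of nonempty subsets of $X$. A diffeomorphism $f:X\to X$ is Anosov if $X$ itself is a hyperbolic set for $f$ (that is, there is a continuous $Df$-invariant splitting $TX = E^s\oplus E^u$ with $E^s$ uniformly contracted by forward iterates of $Df$ and $E^u$ uniformly contracted by backward iterates). For a set-valued map $g : X \to 2^X$ and $A \subset X$, $g(A)=\bigcup_{a\in A} g(a)$, and $g^n(A)=g(g^{n-1}(A))$ with $g^1=g$. A set-valued map $g$ is transitive if for any nonempty open sets $A,B\subset X$ there exists an integer $n\ge 1$ with $g^n(A)\cap B\neq\emptyset$. A map $f : X\to X$ is transitive if for any nonempty open sets $U,V\subset X$ there exists an integer $n\ge 1$ with $f^n(U)\cap V\ne\emptyset$. *)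

(* Defs.v *)
From HB Require Import structures.
From mathcomp Require Import all_boot all_order all_algebra.
From mathcomp Require Import all_classical all_reals all_analysis.

Set Implicit Arguments.
Unset Strict Implicit.
Unset Printing Implicit Defensive.

Import Order.TTheory GRing.Theory Num.Theory.
Import numFieldNormedType.Exports.

Local Open Scope classical_set_scope.
Local Open Scope ring_scope.

(* [U] is meant to be open: only then is this the usual C^k class. *)
Fixpoint Ck_on (R : realType) (V W : normedModType R) (k : nat)
    (U : set V) (f : V -> W) : Prop :=
  if k is k'.+1 then
    (forall x, U x -> differentiable f x) /\
    (forall v, Ck_on k' U (fun x => 'D_v f x))
  else forall x, U x -> {for x, continuous f}.

Definition smooth_on (R : realType) (V W : normedModType R)
    (U : set V) (f : V -> W) : Prop :=
  forall k, Ck_on k U f.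

Section Manifold.
Variables (R : realType) (n : nat) (X : topologicalType).

Local Notation E := 'rV[R]_n.

(* [chart_map] and [chart_inv] are total functions; only their values on
   [chart_dom] and [chart_img] matter. *)
Record chart := Chart {
  chart_dom : set X ;
  chart_img : set E ;
  chart_map :> X -> E ;
  chart_inv : E -> X ;
  chart_dom_open : open chart_dom ;
  chart_img_open : open chart_img ;
  chart_map_img : forall x, chart_dom x -> chart_img (chart_map x) ;
  chart_inv_dom : forall y, chart_img y -> chart_dom (chart_inv y) ;
  chart_mapK : forall x, chart_dom x -> chart_inv (chart_map x) = x ;
  chart_invK : forall y, chart_img y -> chart_map (chart_inv y) = y ;
  chart_map_continuous :
    forall x, chart_dom x -> {for x, continuous chart_map} ;
  chart_inv_continuous :
    forall y, chart_img y -> {for y, continuous chart_inv} }.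

(* The atlas need not be maximal.  [chart_at x] is a preferred chart around x;
   it serves to identify the tangent space T_x X with R^n (see [tcoord]). *)
Record smooth_manifold := SmoothManifold {
  atlas : set chart ;
  chart_at : X -> chart ;
  chart_at_atlas : forall x, atlas (chart_at x) ;
  chart_at_dom : forall x, chart_dom (chart_at x) x ;
  atlas_compatible : forall c d, atlas c -> atlas d ->
    smooth_on (chart_img c `&` chart_inv c @^-1` chart_dom d)
              (d \o chart_inv c) ;
  manifold_hausdorff : hausdorff_space X ;
  manifold_second_countable : @second_countable X }.

Variable M : smooth_manifold.

(* A tangent vector at x is the element v of R^n which is its coordinate vector
   in the chart [chart_at M x]; [tcoord c x v] is its coordinate vector in the
   chart c, and [tvec c y w] is the tangent vector at [chart_inv c y] whose
   coordinate vector in the chart c is w. *)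
Definition tcoord (c : chart) (x : X) (v : E) : E :=
  'd (c \o chart_inv (chart_at M x)) (chart_at M x x) v.

Definition tvec (c : chart) (y : E) (w : E) : E :=
  'd (chart_at M (chart_inv c y) \o chart_inv c) y w.

Definition C1_map (f : X -> X) : Prop :=
  continuous f /\
  forall c d, atlas M c -> atlas M d ->
    Ck_on 1 (chart_img c `&` (f \o chart_inv c) @^-1` chart_dom d)
            (d \o f \o chart_inv c).

(* f is a diffeomorphism with inverse g. *)
Definition diffeomorphism (f g : X -> X) : Prop :=
  [/\ cancel f g, cancel g f, C1_map f & C1_map g].

Definition tangent_diff (f : X -> X) (x : X) (v : E) : E :=
  'd (chart_at M (f x) \o f \o chart_inv (chart_at M x)) (chart_at M x x) v.

(* Df as a self-map of the tangent bundle, whose points are the pairs (x, v)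
   with v a tangent vector at x. *)
Definition tangent_map (f : X -> X) (p : X * E) : X * E :=
  (f p.1, tangent_diff f p.1 p.2).

(* [gram x] is the Gram matrix of the inner product on T_x X. *)
Record riemannian_metric := RiemannianMetric {
  gram : X -> 'M[R]_n ;
  gram_sym : forall x, (gram x)^T = gram x ;
  gram_pos : forall x (v : E), v != 0 -> 0 < (v *m gram x *m v^T) 0 0 ;
  gram_smooth : forall c, atlas M c -> forall v w : E,
    smooth_on (chart_img c)
      (fun y => (tvec c y v *m gram (chart_inv c y) *m (tvec c y w)^T) 0 0
                : R^o) }.

Variable G : riemannian_metric.

Definition tnorm (p : X * E) : R :=
  Num.sqrt ((p.2 *m gram G p.1 *m p.2^T) 0 0).

Definition C1_curve (gamma : R -> X) : Prop :=
  continuous gamma /\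
  forall c, atlas M c ->
    Ck_on 1 (gamma @^-1` chart_dom c) (c \o gamma : R^o -> E).

Definition velocity (gamma : R -> X) (t : R) : E :=
  'D_1 (chart_at M (gamma t) \o gamma : R^o -> E) t.

Definition arc_length (gamma : R -> X) (a b : R) : R :=
  (\int[lebesgue_measure]_(t in `[a, b]) tnorm (gamma t, velocity gamma t))%R.

(* [joined x y L]: some piecewise C^1 curve from x to y has length L.  Such a
   curve is a finite concatenation of C^1 arcs, and every C^1 arc is the
   restriction to a segment of a C^1 curve defined on the whole of R. *)
Inductive joined : X -> X -> R -> Prop :=
| joined_nil x : joined x x 0
| joined_cons gamma a b y L :
    C1_curve gamma -> a <= b -> joined (gamma b) y L ->
    joined (gamma a) y (arc_length gamma a b + L).

(* Points in distinct components are at distance +oo. *)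
Definition rdist (x y : X) : \bar R :=
  ereal_inf [set L%:E | L in joined x y].

Definition rball (y : X) (e : R) : set X := [set z | (rdist y z < e%:E)%E].

Definition continuous_vfield_at (s : X -> E) (x : X) : Prop :=
  forall c, atlas M c -> chart_dom c x ->
    {for x, continuous (fun z => tcoord c z (s z))}.

(* Continuity of a subbundle F of TX: around each point, F has a frame of
   continuous vector fields. *)
Definition continuous_subbundle (F : X -> {vspace E}) : Prop :=
  forall x0 : X, exists k : nat, exists s : 'I_k -> X -> E,
    \forall x \near x0,
      basis_of (F x) [tuple s i x | i < k] /\
      forall i, continuous_vfield_at (s i) x.

Definition invariant_subbundle (f : X -> X) (F : X -> {vspace E}) : Prop :=
  forall x, tangent_diff f x @` [set` F x] = [set` F (f x)].

Definition contracted (f : X -> X) (F : X -> {vspace E}) (C lam : R) : Prop :=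
  forall x (v : E) (k : nat), v \in F x ->
    tnorm (iter k (tangent_map f) (x, v)) <= C * lam ^+ k * tnorm (x, v).

Definition hyperbolic_splitting (f g : X -> X) (Es Eu : X -> {vspace E}) :
    Prop :=
  [/\ forall x, (Es x + Eu x = fullv)%VS /\ (Es x :&: Eu x = 0)%VS,
      continuous_subbundle Es /\ continuous_subbundle Eu,
      invariant_subbundle f Es /\ invariant_subbundle f Eu &
      exists C lam : R, [/\ 0 < C, 0 < lam < 1,
        contracted f Es C lam & contracted g Eu C lam]].

Definition anosov (f : X -> X) : Prop :=
  exists g : X -> X, diffeomorphism f g /\
    exists Es Eu : X -> {vspace E}, hyperbolic_splitting f g Es Eu.

Definition perturbation (f : X -> X) (e : R) : X -> set X :=
  fun x => rball (f x) e.

Lemma perturbation_nonempty (f : X -> X) (e : R) (x : X) :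
  0 < e -> perturbation f e x !=set0.
Proof.
move=> e0; exists (f x); rewrite /perturbation /rball /rdist /=.
apply: (@le_lt_trans _ _ 0%:E); last by rewrite lte_fin.
by apply: ereal_inf_lbound; exists 0 => //; exact: joined_nil.
Qed.

End Manifold.

Section Transitivity.
Variable X : topologicalType.

Definition sv_image (g : X -> set X) (A : set X) : set X :=
  \bigcup_(a in A) g a.

Definition sv_transitive (g : X -> set X) : Prop :=
  forall A B : set X, open A -> open B -> A !=set0 -> B !=set0 ->
  exists k : nat, (1 <= k)%N /\ iter k (sv_image g) A `&` B !=set0.

Definition topologically_transitive (f : X -> X) : Prop :=
  forall U V : set X, open U -> open V -> U !=set0 -> V !=set0 ->
  exists k : nat, (1 <= k)%N /\ iter k f @` U `&` V !=set0.

End Transitivity.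

(* Main.v *)
(** Chain transitivity plus finite shadowing gives transitivity: a pseudo-orbit
    of [f] from [U] to [V] is followed by a true orbit.  For shadowing, replace
    [f] by an iterate [h] whose contraction beats the distortion of a finite
    atlas.  In charts at the points [x_i] of a pseudo-orbit of [h], with stable
    and unstable projections [P_i] and [Q_i], seek points [v_i] such that the
    stable part of [v_(i+1)] is that of [h v_i] and the unstable part of [v_i]
    is that of [h^-1 v_(i+1)], with zero stable part at the start and zero
    unstable part at the end.  This is a fixed point problem for a contraction,
    and at its solution [h v_i - v_(i+1)] is unstable, while the difference of
    the preimages under [h^-1] is stable; as [h^-1] nearly preserves unstable
    vectors, both differences are zero. *)

Require Import Defs.
From HB Require Import structures.
From mathcomp Require Import all_boot all_order all_algebra.
From mathcomp Require Import all_classical all_reals all_analysis.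
From mathcomp Require Import ring lra.

Set Implicit Arguments.
Unset Strict Implicit.
Unset Printing Implicit Defensive.

Import Order.TTheory GRing.Theory Num.Def Num.Theory.
Import numFieldNormedType.Exports.
Local Open Scope classical_set_scope.
Local Open Scope ring_scope.

(** * Matrix norms and a fixed point lemma *)

(** Charts, metric and splitting give estimates near single points only, while shadowing asks for
    constants valid along pseudo-orbits of any length. Every estimate is therefore proved for pairs
    [(y, z)] near [(x, h x)], and [uniformize] spreads it, by compactness, to all pairs joined by
    [N] steps with small jumps. The constants come in a fixed order: [K] from the finite atlas, [N]
    from [K], then the radius [rho] of linear approximation, the shadowing radius [r], and last the
    jump size [d]. Determining the unstable parts through [h^-1] makes both halves of the fixed
    point problem contract without inverting the derivative on the unstable bundle. Transitivity
    supplies an arbitrary time [k], whereas [h] advances by [N] at a time. The target [V] is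
    therefore replaced by a neighbourhood of [v0] adapted to up to [N] further steps. *)

HB.instance Definition _ (R : realType) m n := Complete.on 'M[R]_(m, n).

Section MatrixNorm.
Variable R : realType.

Lemma mx_norm_le m n (A : 'M[R]_(m, n)) (r : R) :
  0 <= r -> (forall i j, `|A i j| <= r) -> `|A| <= r.
Proof.
move=> r0 Ar; rewrite [leLHS]/normr /= mx_normrE.
by apply/bigmax_leP; split => // -[i j] _ /=.
Qed.

Lemma mx_entry_le m n (A : 'M[R]_(m, n)) i j : `|A i j| <= `|A|.
Proof.
rewrite [leRHS]/normr /= mx_normrE.
by apply/bigmax_geP; right; exists (i, j).
Qed.

Lemma norm_mulmx m n p (A : 'M[R]_(m, n)) (B : 'M[R]_(n, p)) :
  `|A *m B| <= n%:R * `|A| * `|B|.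
Proof.
apply: mx_norm_le => [|i j]; first by rewrite !mulr_ge0.
rewrite mxE (le_trans (ler_norm_sum _ _ _))//.
apply: (@le_trans _ _ (\sum_(k < n) `|A| * `|B|)).
  by apply: ler_sum => k _; rewrite normrM ler_pM ?mx_entry_le.
by rewrite sumr_const card_ord -mulrA mulr_natl.
Qed.

(** The hypothesis concerns images of basis vectors because [Ck_on] gives continuity of directional
    derivatives, one direction at a time. *)
Lemma norm_mulmx_rows n p (u : 'rV[R]_n) (A B : 'M[R]_(n, p)) (e : R) k : 0 <= e ->
  (forall j, `|(delta_mx 0 j : 'rV[R]_n) *m A - (delta_mx 0 j : 'rV[R]_n) *m B| <= e) ->
  `|(u *m A) 0 k - (u *m B) 0 k| <= n%:R * e * `|u|.
Proof.
move=> e0 ABe; have -> : (u *m A) 0 k - (u *m B) 0 k = (u *m (A - B)) 0 k.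
  by rewrite mulmxBr !mxE.
rewrite (le_trans (mx_entry_le _ _ _))// mulmx_sum_row (le_trans (ler_norm_sum _ _ _))//.
apply: (@le_trans _ _ (\sum_(j < n) e * `|u|)); last first.
  by rewrite sumr_const card_ord -mulrA mulr_natl.
apply: ler_sum => j _; rewrite normrZ mulrC ler_pM ?mx_entry_le//.
by have := ABe j; rewrite -mulmxBr -rowE.
Qed.

Lemma eq_mulmx n p (A B : 'M[R]_(n, p)) : (forall w : 'rV[R]_n, w *m A = w *m B) -> A = B.
Proof. by move=> AB; apply/row_matrixP => i; rewrite !rowE AB. Qed.

(** Banach's theorem in the sup norm: the family is stored as the rows of a single matrix, whose
    norm is the maximum of the norms of its rows. *)
Lemma finite_family_fixpoint (I : finType) n (T : (I -> 'rV[R]_n) -> I -> 'rV[R]_n)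
    (r : R) : 0 <= r ->
  (forall v, (forall i, `|v i| <= r) -> forall i, `|T v i| <= r) ->
  (forall v w m, (forall i, `|v i| <= r) -> (forall i, `|w i| <= r) ->
    (forall i, `|v i - w i| <= m) -> forall i, `|T v i - T w i| <= m / 2) ->
  exists2 v, forall i, `|v i| <= r & forall i, T v i = v i.
Proof.
move=> r0 Tr Tc.
pose fam (A : 'M[R]_(#|I|, n)) i := row (enum_rank i) A.
pose mat (v : I -> 'rV[R]_n) : 'M[R]_(#|I|, n) := \matrix_(j, k) v (enum_val j) 0 k.
have famB A B i : `|fam A i - fam B i| <= `|A - B|.
  apply: mx_norm_le => // j k; rewrite !mxE.
  by have := mx_entry_le (A - B) (enum_rank i) k; rewrite !mxE.
have matE v i : fam (mat v) i = v i.
  by apply/rowP => k; rewrite !mxE enum_rankK.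
have matB v w m : 0 <= m -> (forall i, `|v i - w i| <= m) -> `|mat v - mat w| <= m.
  move=> m0 vw; apply: mx_norm_le => // j k; rewrite !mxE.
  by have := mx_entry_le (v (enum_val j) - w (enum_val j)) 0 k;
    rewrite !mxE => /le_trans; apply.
have fam0 i : fam 0 i = 0 by apply/rowP => k; rewrite !mxE.
pose U := [set A : 'M[R]_(#|I|, n) | `|A| <= r].
have famU A : U A -> forall i, `|fam A i| <= r.
  by move=> UA i; rewrite -[fam A i]subr0 -(fam0 i) (le_trans (famB _ _ _))// subr0.
have mat0 : mat 0 = 0 by apply/matrixP => j k; rewrite !mxE.
have matU v : (forall i, `|v i| <= r) -> U (mat v).
  by move=> vr; rewrite /U /= -[mat v]subr0 -mat0; apply: matB => // i; rewrite subr0.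
pose Phi A := mat (T (fam A)).
have PhiU : set_fun U U Phi by move=> A UA; apply: matU; apply: Tr; exact: famU.
have [||| A UA AE] := @banach_fixed_point R 'M[R]_(#|I|, n) U (mkfun_fun PhiU).
- exists (1 / 2)%:nng; split => /=; first by rewrite /=; lra.
  move=> [A B] [/= UA UB]; rewrite mulrC mul1r; apply: matB => [|i].
    by rewrite divr_ge0.
  by apply: Tc => //; [exact: famU| exact: famU].
- apply: (@closed_comp _ _ (@normr R 'M[R]_(#|I|, n)) [set x | x <= r]); last exact: closed_le.
  by move=> A _; exact: norm_continuous.
- by exists 0; rewrite /U /= normr0.
exists (fam A); first exact: famU.
by move=> i; rewrite [in RHS](_ : A = Phi A) ?matE.
Qed.

End MatrixNorm.

(** * Finite shadowing in coordinates *)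

Section Shadowing.
Variables (R : realType) (n : nat).
Local Notation E := 'rV[R]_n.
Local Notation mat := 'M[R]_n.

(** Bounds the operator norm; the norm of matrices themselves is the largest entry, which is
    submultiplicative only up to a factor [n]. *)
Definition opb (A : mat) (k : R) := forall v : E, `|v *m A| <= k * `|v|.

Lemma opbP (A : mat) : opb A (n%:R * `|A|).
Proof.
by move=> v; rewrite (le_trans (norm_mulmx _ _))// mulrAC.
Qed.

Lemma opbW (A : mat) k l : k <= l -> opb A k -> opb A l.
Proof. by move=> kl Ak v; apply: le_trans (Ak v) _; rewrite ler_wpM2r. Qed.

(** The map [F - A] is [eta]-Lipschitz on the ball. [A] need not be the derivative at [a], so one
    matrix can serve for all nearby centers. *)
Definition approx_linear (F : E -> E) (a : E) (rho : R) (A : mat) (eta : R) :=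
  forall v w, `|v - a| <= rho -> `|w - a| <= rho ->
    `|F v - F w - (v - w) *m A| <= eta * `|v - w|.

(* [F] is the dynamics read near [a], [G] its inverse read near [b]; the
   splittings at [a] and [b] are given by the projections [P] and [P']. *)
Definition hyp_lin (K rho : R) (a : E) (P : mat) (b : E) (P' : mat) (F G : E -> E) :=
  exists D B : mat, exists eta kappa L : R,
  [/\ approx_linear F a rho D eta /\ approx_linear G b rho B eta,
      [/\ opb (P *m D *m P') (1/8), opb ((1%:M - P) *m D *m P') (1/8),
          opb ((1%:M - P') *m B *m (1%:M - P)) (1/8) &
          opb (P' *m B *m (1%:M - P)) (1/8)],
      8 * K ^+ 2 * eta <= 1 /\ B *m D = 1%:M &
      [/\ opb D L, 0 <= L, opb ((1%:M - P') *m B *m P) kappa &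
          L * (kappa + K * eta + eta) < 1]].

(** Two radii are needed: the orbit is sought within [r] of the centers, but its image under [F] is
    only known to lie within [rho], where the estimate on [G] still holds. *)
Definition hyp_step (K rho r e : R) (a : E) (P : mat) (b : E) (P' : mat)
    (F G : E -> E) :=
  [/\ hyp_lin K rho a P b P' F G,
      forall v, `|v - a| <= r -> `|F v - b| <= rho /\ G (F v) = v,
      `|F a - b| <= e & `|G b - a| <= e].

(** One estimate serves both halves of the fixed point operator: [F] followed by the stable
    projection, and [G] followed by the unstable one. The factor 1/2 is 1/8 + 1/8 from the two
    linear blocks, plus [2 * K ^+ 2 * eta <= 1/4] from the remainder, as [v - w] has norm at most
    [2 * K * m]. *)
Lemma approx_linear_contract F a rho (D P Q Q' : mat) eta (K m : R) v w x y :
  approx_linear F a rho D eta -> 1 <= K -> 8 * K ^+ 2 * eta <= 1 ->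
  opb P K -> opb Q K -> opb Q' K ->
  opb (P *m D *m Q') (1/8) -> opb (Q *m D *m Q') (1/8) ->
  `|v - a| <= rho -> `|w - a| <= rho ->
  `|x| <= m -> `|y| <= m -> v - w = x *m P + y *m Q ->
  `|(F v - F w) *m Q'| <= m / 2.
Proof.
move=> FD K1 Keta PK QK Q'K PD QD va wa xm ym vw.
have m0 : 0 <= m := le_trans (normr_ge0 _) xm.
have K0 : 0 <= K by lra.
have vwm : `|v - w| <= 2 * K * m.
  rewrite vw (le_trans (ler_normD _ _))// (le_trans (lerD (PK _) (QK _)))//.
  have := ler_wpM2l K0 xm; have := ler_wpM2l K0 ym; lra.
have -> : (F v - F w) *m Q' = (F v - F w - (v - w) *m D) *m Q'
    + (x *m (P *m D *m Q') + y *m (Q *m D *m Q')).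
  by rewrite !mulmxA -2!mulmxDl -vw -mulmxDl subrK.
rewrite (le_trans (ler_normD _ _))// (le_trans (lerD (Q'K _) (ler_normD _ _)))//.
have := PD x; have := QD y.
have := ler_wpM2l K0 (FD _ _ va wa).
suff : K * (eta * `|v - w|) <= m / 4 by lra.
have [eta0|eta0] := leP eta 0.
  have : K * (eta * `|v - w|) <= 0.
    by rewrite mulr_ge0_le0// mulr_le0_ge0.
  lra.
have : K * eta * `|v - w| <= K * eta * (2 * K * m).
  by rewrite ler_wpM2l// mulr_ge0// ltW.
have : m * (8 * K ^+ 2 * eta) <= m * 1 by rewrite ler_wpM2l.
nra.
Qed.

Lemma finite_shadowing (K rho r e : R) (m : nat) (a : nat -> E) (P : nat -> mat)
    (F G : nat -> E -> E) :
  1 <= K -> 0 < r <= rho -> 4 * K ^+ 2 * e <= r ->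
  (forall i, [/\ P i *m P i = P i, opb (P i) K & opb (1%:M - P i) K]) ->
  (forall i, (i < m)%N ->
    hyp_step K rho r e (a i) (P i) (a i.+1) (P i.+1) (F i) (G i)) ->
  exists v : nat -> E, (forall i, (i <= m)%N -> `|v i - a i| <= r) /\
    (forall i, (i < m)%N -> F i (v i) = v i.+1).
Proof.
move=> K1 /andP[r0 rrho] Ke PP step.
have K0 : 0 < K by lra.
(* Two coordinates of size [s], each passed through a projection of norm at most [K], give a point
   within [r] of [a i]. *)
pose s := r / (2 * K).
have s0 : 0 <= s by rewrite divr_ge0//; lra.
have sK : 2 * K * s = r by rewrite /s; field; lra.
have Kes : K * e <= s / 2.
  rewrite -(ler_pM2l (_ : 0 < 4 * K)); last by lra.
  have -> : 4 * K * (s / 2) = r by rewrite -sK; field.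
  by apply: le_trans Ke; rewrite le_eqVlt; apply/orP; left; apply/eqP; ring.
(* The coordinates are free vectors, projected only here, so that the operator acts on a plain ball.
   For [i > m] the index [inord i] falls back to 0; the bounds on [V] hold there too, and only
   [i <= m] enters the conclusion. *)
pose V (z : 'I_m.+1 * bool -> E) i :=
  a i + z (inord i, true) *m P i + z (inord i, false) *m (1%:M - P i).
pose T z (j : 'I_m.+1 * bool) : E :=
  let i := nat_of_ord j.1 in
  if j.2 then (if i is i'.+1 then (F i' (V z i') - a i) *m P i else 0)
  else if (i < m)%N then (G i (V z i.+1) - a i) *m (1%:M - P i) else 0.
have PQ i : (1%:M - P i) *m P i = 0 /\ P i *m (1%:M - P i) = 0.
  have [PPi _ _] := PP i.
  by rewrite mulmxBl mulmxBr mulmx1 mul1mx PPi subrr.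
have QQ i : (1%:M - P i) *m (1%:M - P i) = 1%:M - P i.
  by rewrite mulmxBr mulmx1 (PQ i).1 subr0.
have VB z w i : V z i - V w i = (z (inord i, true) - w (inord i, true)) *m P i
    + (z (inord i, false) - w (inord i, false)) *m (1%:M - P i).
  by rewrite /V !mulmxBl; apply/rowP => k; rewrite !mxE; ring.
have Va z i : (forall j, `|z j| <= s) -> `|V z i - a i| <= r.
  move=> zs; have [_ PK QK] := PP i.
  have -> : V z i - a i = z (inord i, true) *m P i + z (inord i, false) *m (1%:M - P i).
    by rewrite /V [LHS]addrC -addrA addKr.
  rewrite (le_trans (ler_normD _ _))//.
  rewrite (le_trans (lerD (PK _) (QK _)))// -sK.
  have := ler_wpM2l (ltW K0) (zs (inord i, true)).
  have := ler_wpM2l (ltW K0) (zs (inord i, false)); lra.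
have Tc z w c : (forall j, `|z j| <= s) -> (forall j, `|w j| <= s) ->
    (forall j, `|z j - w j| <= c) -> forall j, `|T z j - T w j| <= c / 2.
  move=> zs ws zw [[i im] b].
  have c0 : 0 <= c := le_trans (normr_ge0 _) (zw (ord0, true)).
  have Vr u k : (forall j, `|u j| <= s) -> `|V u k - a k| <= rho.
    by move=> us; exact: le_trans (Va u k us) rrho.
  have [_ PK QK] := PP i.
  rewrite /T /=; case: b.
    case: i im PK QK => [|i] im PK QK; first by rewrite subrr normr0 divr_ge0.
    have [[D [B [eta [kappa [L [[FD GB] [h1 h2 _ _] [h5 h6] _]]]]]] _ _ _] := step i im.
    have [_ PKi QKi] := PP i.
    rewrite -mulmxBl opprB addrA subrK.
    exact: (approx_linear_contract FD K1 h5 PKi QKi PK h1 h2 (Vr _ _ zs) (Vr _ _ ws)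
      (zw _) (zw _) (VB z w i)).
  case: ifPn => mi; last by rewrite subrr normr0 divr_ge0.
  have [[D [B [eta [kappa [L [[FD GB] [_ _ h1 h2] [h5 h6] _]]]]]] _ _ _] := step i mi.
  have [_ PKi QKi] := PP i.+1.
  rewrite -mulmxBl opprB addrA subrK.
  have {}VB := etrans (VB z w i.+1) (addrC _ _).
  exact: (approx_linear_contract GB K1 h5 QKi PKi QK h1 h2 (Vr _ _ zs) (Vr _ _ ws)
      (zw _) (zw _) VB).
(* [T] sends 0 to a family of size at most [K * e <= s / 2], and by contraction [T z] is within
   [s / 2] of it. *)
have Ts z : (forall j, `|z j| <= s) -> forall j, `|T z j| <= s.
  move=> zs j.
  rewrite [leRHS](_ : s = s / 2 + s / 2); last by lra.
  rewrite -[T z j](subrK (T (fun=> 0) j)) (le_trans (ler_normD _ _))// lerD//.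
    by apply: Tc => // k; rewrite ?normr0// subr0.
  have V0 i : V (fun=> 0) i = a i by rewrite /V !mul0mx !addr0.
  case: j => [[i im] b]; rewrite /T /= !V0.
  have [_ PK QK] := PP i.
  case: b.
    case: i im PK QK => [|i] im PK QK; first by rewrite normr0 divr_ge0.
    have [_ _ Fe Ge] := step i im.
    rewrite V0 (le_trans (PK _))// (le_trans _ Kes)//; exact: (ler_wpM2l (ltW K0) Fe).
  case: ifPn => mi; last by rewrite normr0 divr_ge0.
  have [_ _ Fe Ge] := step i mi.
  rewrite (le_trans (QK _))// (le_trans _ Kes)//; exact: (ler_wpM2l (ltW K0) Ge).
have [z zs zE] := finite_family_fixpoint s0 Ts Tc.
exists (V z); split=> [i _|i im]; first exact: Va.
have [[D [B [eta [kappa [L [[FD GB] _ [h5 BD] [DL L0 Qk Lk]]]]]]] FG _ _] := step i im.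
have [Frho GF] := FG _ (Va z i zs).
pose w := F i (V z i); pose d := w - V z i.+1.
have [PPi PKi QKi] := PP i; have [PPj PKj QKj] := PP i.+1.
have zP : z (inord i.+1, true) = (w - a i.+1) *m P i.+1.
  by rewrite -zE /T /= inordK.
have zQ : z (inord i, false) = (G i (V z i.+1) - a i) *m (1%:M - P i).
  by rewrite -zE /T /= inordK ?im// ltnW.
have zPP : z (inord i.+1, true) *m P i.+1 = z (inord i.+1, true).
  by rewrite zP -mulmxA PPj.
have zQP : z (inord i.+1, false) *m (1%:M - P i.+1) *m P i.+1 = 0.
  by rewrite -mulmxA (PQ _).1 mulmx0.
have dP : d *m P i.+1 = 0.
  rewrite /d {1}/V opprD addrA opprD addrA mulmxBl zQP subr0.
  by rewrite mulmxBl mulmxBl -mulmxA PPj zPP zP mulmxBl subrr.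
have zQQ : z (inord i, false) *m (1%:M - P i) = z (inord i, false).
  by rewrite zQ -mulmxA QQ.
pose g := V z i - G i (V z i.+1).
have gQ : g *m (1%:M - P i) = 0.
  have -> : g = z (inord i, true) *m P i + z (inord i, false) *m (1%:M - P i)
                - (G i (V z i.+1) - a i).
    by rewrite /g {1}/V; apply/rowP => k; rewrite !mxE; ring.
  by rewrite mulmxBl -zQ mulmxDl -mulmxA (PQ _).2 mulmx0 add0r !zQQ subrr.
have gP : g = g *m P i.
  by rewrite -{1}[g]mulmx1 -[X in g *m X](subrK (P i)) mulmxDr gQ add0r.
have dQ : d = d *m (1%:M - P i.+1) by rewrite mulmxBr mulmx1 dP subr0.
have gd : `|g - d *m B| <= eta * `|d|.
  rewrite /g -{1}GF; apply: GB => //.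
  by rewrite (le_trans (Va _ _ zs)).
(* Since [g] is stable, [P i] fixes it; since [d] is unstable, the stable part of [d *m B] has norm
   at most [kappa * |d|]. *)
have gle : `|g| <= (kappa + K * eta) * `|d|.
  rewrite {1}gP -[in leLHS](subrKC (d *m B) g) mulmxDl (le_trans (ler_normD _ _))// mulrDl.
  apply: lerD; first by rewrite {1}dQ -[_ *m _ *m B]mulmxA -mulmxA Qk.
  by rewrite (le_trans (PKi _))// -mulrA ler_wpM2l// ltW.
have dBle : `|d *m B| <= (kappa + K * eta + eta) * `|d|.
  rewrite -[d *m B](subrKC g) (le_trans (ler_normD _ _))// [leRHS]mulrDl.
  by rewrite lerD// distrC.
(* [D] recovers [d] from [d *m B] at the cost of a factor [L]; the total factor is below 1, which
   forces [d = 0]. *)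
have dle : `|d| <= L * (kappa + K * eta + eta) * `|d|.
  rewrite -{1}[d]mulmx1 -BD mulmxA (le_trans (DL _))// -[leRHS]mulrA ler_wpM2l//.
apply/eqP; rewrite -subr_eq0 -normr_eq0 -/w -/d eq_le normr_ge0 andbT.
have [//|d0] := leP `|d| 0.
by move: dle; rewrite leNgt gtr_pMl// Lk.
Qed.
End Shadowing.

(** * Strict differentiability *)

Lemma nbhs_norm_le (R : realType) (V : normedModType R) (a : V) (S : set V) :
  nbhs a S <-> exists2 r : R, 0 < r & forall y, `|y - a| <= r -> S y.
Proof.
split.
  move=> /nbhs_ballP[e /= e0 eS]; exists (e / 2); first by rewrite divr_gt0.
  move=> y ya; apply: eS; rewrite -ball_normE /= distrC (le_lt_trans ya)//.
  by rewrite ltr_pdivrMr// ltr_pMr// ltr1n.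
move=> [r r0 rS]; apply/nbhs_ballP; exists r => //= y.
by rewrite -ball_normE /= distrC => /ltW; exact: rS.
Qed.

(* Sealed, as two differentials that do not match are compared by unfolding
   them down to a choice operator. *)
HB.lock Definition jac (R : realType) n (F : 'rV[R]_n -> 'rV[R]_n) (a : 'rV[R]_n) :
  'M[R]_n := jacobian F a.

Section StrictDifferentiability.
Variables (R : realType) (n : nat).
Local Notation E := 'rV[R]_n.
Local Notation mat := 'M[R]_n.

(** Strict rather than plain differentiability: contraction estimates compare two arbitrary points
    of a ball, not one point with its center. *)
Definition sdiff (F : E -> E) (a : E) (A : mat) :=
  forall eta, 0 < eta -> exists2 rho, 0 < rho & approx_linear F a rho A eta.

Lemma sdiff_near F F' a A : (\forall y \near a, F y = F' y) ->
  sdiff F a A -> sdiff F' a A.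
Proof.
move=> /nbhs_norm_le[r r0 FF'] FA eta eta0.
have [rho rho0 FAr] := FA eta eta0.
exists (minr rho r); first by rewrite lt_min rho0.
move=> v w; rewrite !le_min => /andP[va va'] /andP[wa wa'].
by rewrite -!FF'//; exact: FAr.
Qed.

Lemma sdiff_id a : sdiff id a 1%:M.
Proof.
move=> eta eta0; exists 1 => // v w _ _; rewrite mulmx1 subrr normr0.
by rewrite mulr_ge0// ltW.
Qed.

Lemma sdiff_lipschitz F a A : sdiff F a A ->
  exists L, 0 < L /\ exists2 rho, 0 < rho &
    forall v w, `|v - a| <= rho -> `|w - a| <= rho -> `|F v - F w| <= L * `|v - w|.
Proof.
move=> /(_ 1 ltr01)[rho rho0 FA]; exists (1 + n%:R * `|A|).
split; first by rewrite ltr_wpDr// mulr_ge0.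
exists rho => // v w va wa.
rewrite -[F v - F w](subrK ((v - w) *m A)) (le_trans (ler_normD _ _))// mulrDl.
by rewrite lerD// ?FA// opbP.
Qed.

Lemma sdiff_continuous F a A : sdiff F a A -> {for a, continuous F}.
Proof.
move=> /sdiff_lipschitz[L [L0 [rho rho0 FL]]].
apply/(@cvgrPdist_le _ _ _ (nbhs a)) => e e0; apply/nbhs_norm_le; exists (minr rho (e / L)).
  by rewrite lt_min rho0 divr_gt0.
move=> y; rewrite le_min => /andP[yr ye]; rewrite distrC.
rewrite (le_trans (FL _ _ yr _)) ?subrr ?normr0 ?(ltW rho0)//.
by rewrite mulrC -ler_pdivlMr.
Qed.

Lemma sdiff_comp F G a A B : sdiff F a A -> sdiff G (F a) B ->
  sdiff (G \o F) a (A *m B).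
Proof.
move=> FA GB eta eta0.
have [L [L0 [r0 r00 FL]]] := sdiff_lipschitz FA.
pose nB := n%:R * `|B| + 1.
have nB0 : 0 < nB by rewrite ltr_wpDl// mulr_ge0.
have [r1 r10 FA1] := FA (eta / 2 / nB) ltac:(by rewrite !divr_gt0).
have [r2 r20 GB2] := GB (eta / 2 / L) ltac:(by rewrite !divr_gt0).
exists (minr r0 (minr r1 (r2 / L))); first by rewrite !lt_min r00 r10 divr_gt0.
move=> v w; rewrite !le_min => /and3P[v0 v1 v2] /and3P[w0 w1 w2] /=.
have Fr u : `|u - a| <= r0 -> `|u - a| <= r2 / L -> `|F u - F a| <= r2.
  move=> u0 u2; rewrite (le_trans (FL _ _ u0 _)) ?subrr ?normr0 ?(ltW r00)//.
  by rewrite mulrC -ler_pdivlMr.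
have -> : G (F v) - G (F w) - (v - w) *m (A *m B) =
    (G (F v) - G (F w) - (F v - F w) *m B) + (F v - F w - (v - w) *m A) *m B.
  by rewrite [(_ - (v - w) *m A) *m B]mulmxBl mulmxA addrA subrK.
rewrite (le_trans (ler_normD _ _))// [eta]splitr mulrDl lerD//.
  rewrite (le_trans (GB2 _ _ (Fr _ v0 v2) (Fr _ w0 w2)))//.
  rewrite (le_trans (ler_wpM2l _ (FL _ _ v0 w0))) ?divr_ge0 ?(ltW eta0) ?(ltW L0)//.
  by rewrite mulrA divfK// gt_eqF.
rewrite (le_trans (opbP _ _))//.
rewrite (le_trans (ler_wpM2l _ (FA1 _ _ v1 w1))) ?mulr_ge0//.
rewrite [leLHS]mulrA ler_wpM2r// mulrC -[leLHS]mulrA ler_piMr ?divr_ge0 ?(ltW eta0)//.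
by rewrite ler_pdivrMl// mulr1 /nB lerDl.
Qed.

Lemma mul_jac F (a v : E) : v *m jac F a = ('d F a v : E).
Proof. by rewrite jac.unlock /jacobian mul_rV_lin1. Qed.

Lemma sdiff_diff F a A : sdiff F a A ->
  differentiable F a /\ 'd F a = (mulmxr A : E -> E) :> (E -> E).
Proof.
move=> FA.
have cA : continuous (mulmxr A : E -> E).
  move=> v; apply/(@cvgrPdist_le _ _ _ (nbhs v)) => e e0; apply/nbhs_norm_le.
  have k0 : 0 < n%:R * `|A| + 1 by rewrite ltr_wpDl// mulr_ge0.
  exists (e / (n%:R * `|A| + 1)); first by rewrite divr_gt0.
  move=> w wv; rewrite /= -mulmxBl (le_trans (opbP _ _))// distrC.
  rewrite (le_trans (ler_wpM2l _ wv)) ?mulr_ge0// mulrCA ler_piMr ?(ltW e0)//.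
  by rewrite ler_pdivrMr// mul1r lerDl.
have dA : F \o shift a = cst (F a) + (mulmxr A : E -> E) +o_ (0 : E) id.
  apply/eqaddoP => eps eps0.
  have [rho rho0 Fr] := FA eps eps0.
  apply/nbhs_norm_le; exists rho => // v; rewrite subr0 => vr.
  have := Fr (v + a) a; rewrite addrK subrr normr0 => /(_ vr (ltW rho0)).
  by rewrite /= opprD addrA.
have dFA := diff_unique cA dA; split => //.
by apply/diff_locallyP; rewrite dFA.
Qed.

Lemma sdiff_jac F a A : sdiff F a A -> jac F a = A.
Proof.
move=> /sdiff_diff[_ dF]; apply/row_matrixP => i.
by rewrite !rowE mul_jac dF.
Qed.

Lemma is_derive_line (F : E -> E) (w u : E) (t : R) k :
  differentiable F (w + t *: u) ->
  is_derive t 1 (fun s => F (w + s *: u) 0 k) ((u *m jac F (w + t *: u)) 0 k).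
Proof.
move=> dF; pose l (s : R) := F (w + s *: u).
have lE : (fun h : R => h^-1 *: ((l \o shift t) (h *: 1) - l t)) =
    (fun h : R => h^-1 *: ((F \o shift (w + t *: u)) (h *: u) - F (w + t *: u))).
  apply/funext => h; rewrite /l /= [h *: 1]mulr1 scalerDl.
  by rewrite addrCA.
have dl : derivable l t 1 by rewrite /derivable lE; exact: diff_derivable.
have := (derivable_mxP l t 1).1 dl 0 k => dlk.
split => //; rewrite mul_jac -deriveE//.
have -> : 'D_u F (w + t *: u) = 'D_1 l t by rewrite /derive lE.
by rewrite derive_mx// mxE.
Qed.

(** The mean value theorem on the segment from [w] to [v], one coordinate at a time. The
    intermediate point depends on the coordinate, but the derivative is close to that at [a] on the
    whole ball. *)
Lemma Ck1_sdiff (U : set E) (F : E -> E) (a : E) :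
  nbhs a U -> Ck_on 1 U F -> sdiff F a (jac F a).
Proof.
move=> aU [dF cF] eta eta0.
have Ua := nbhs_singleton aU.
have jacE (y : E) : U y -> forall j, (delta_mx 0 j : E) *m jac F y = 'D_(delta_mx 0 j) F y.
  by move=> Uy j; rewrite mul_jac; apply/esym/deriveE/dF.
pose e := eta / n.+1%:R.
have e0 : 0 < e by rewrite divr_gt0.
have Dle (y u : E) : U y ->
    (forall j, `|'D_(delta_mx 0 j) F y - 'D_(delta_mx 0 j) F a| <= e) ->
    forall k, `|(u *m jac F y) 0 k - (u *m jac F a) 0 k| <= n%:R * e * `|u|.
  move=> Uy Dy k; apply: norm_mulmx_rows => [|j]; first exact: ltW.
  by rewrite (jacE _ Uy) (jacE _ Ua); exact: Dy.
have /nbhs_norm_le[r r0 rP] : \forall y \near a, U y /\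
    forall j, `|'D_(delta_mx 0 j) F y - 'D_(delta_mx 0 j) F a| <= e.
  apply: filterI => //.
  apply: (@filter_forall _ _ (fun j y =>
    `|'D_(delta_mx 0 j) F y - 'D_(delta_mx 0 j) F a| <= e) (nbhs a) (nbhs_filter a)) => j.
  have /cvgrPdist_le/(_ e e0) := cF (delta_mx 0 j) a Ua.
  by apply: (@filterS _ _ (nbhs_filter a)) => y Hy; rewrite distrC.
exists r => // v w va wa; pose u := v - w.
apply: mx_norm_le => [|i k]; first by rewrite mulr_ge0// ltW.
rewrite {i}ord1 -/u.
have seg (t : R) : 0 <= t <= 1 -> `|w + t *: u - a| <= r.
  move=> /andP[t0 t1].
  have -> : w + t *: u - a = (1 - t) *: (w - a) + t *: (v - a).
    by apply/rowP => j; rewrite !mxE; ring.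
  rewrite (le_trans (ler_normD _ _))// !normrZ !ger0_norm ?subr_ge0//.
  have : (1 - t) * `|w - a| <= (1 - t) * r by rewrite ler_wpM2l// subr_ge0.
  have : t * `|v - a| <= t * r by rewrite ler_wpM2l.
  lra.
have dseg (t : R) : 0 <= t <= 1 -> is_derive t 1 (fun s : R => F (w + s *: u) 0 k)
    ((u *m jac F (w + t *: u)) 0 k).
  by move=> /seg/rP[? _]; apply: is_derive_line; exact: dF.
have [||c] := @MVT_segment R (fun s : R => F (w + s *: u) 0 k)
   (fun t : R => (u *m jac F (w + t *: u)) 0 k) 0 1 ler01.
- by move=> t; rewrite in_itv /= => /andP[t0 t1]; apply: dseg; rewrite !ltW.
- apply: derivable_within_continuous => t; rewrite in_itv /= => t01.
  by have [] := dseg t t01.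
rewrite in_itv /= => c01; rewrite scale1r scale0r addr0 subr0 mulr1.
have -> : w + u = v by rewrite /u addrC subrK.
have subE (x y : E) : (x - y) 0 k = x 0 k - y 0 k by rewrite !mxE.
rewrite 2!subE => ->.
have [Uy Dy] := rP _ (seg c c01).
apply: le_trans (Dle _ _ Uy Dy k) _.
rewrite ler_wpM2r// /e mulrCA ler_piMr ?(ltW eta0)//.
by rewrite ler_pdivrMr// mul1r ler_nat.
Qed.

End StrictDifferentiability.

(** * Maps read in charts *)

Section ChartCalculus.
Variables (R : realType) (n : nat) (X : topologicalType) (M : smooth_manifold R n X).
Local Notation E := 'rV[R]_n.
Local Notation mat := 'M[R]_n.
Implicit Types (c d e : chart R n X) (h : X -> X) (x : X).

Definition rep c h d : E -> E := d \o h \o chart_inv c.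

(** Continuity is included because a composite read in charts factors through an intermediate chart
    only near points whose image stays in its domain. *)
Definition sdiff_at h x := {for x, continuous h} /\
  forall c d, atlas M c -> atlas M d -> chart_dom c x -> chart_dom d (h x) ->
    sdiff (rep c h d) (c x) (jac (rep c h d) (c x)).

Lemma near_chart_inv c x (S : set X) : chart_dom c x -> nbhs x S ->
  \forall y \near c x, S (chart_inv c y).
Proof.
move=> cx xS; have cy := chart_map_img cx.
by apply: (chart_inv_continuous cy); rewrite /= chart_mapK.
Qed.

Lemma near_chart_img c x : chart_dom c x -> \forall y \near c x, chart_img c y.
Proof.
move=> cx; apply: open_nbhs_nbhs; split; first exact: chart_img_open.
exact: chart_map_img.
Qed.

Lemma near_chart_dom c x : chart_dom c x -> nbhs x (chart_dom c).
Proof. by move=> cx; apply: open_nbhs_nbhs; split => //; exact: chart_dom_open. Qed.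

Lemma near_chart_map c x (S : set E) : chart_dom c x -> nbhs (c x) S ->
  \forall y \near x, S (c y).
Proof. by move=> cx cS; apply: (chart_map_continuous cx). Qed.

Lemma Ck1_sdiff_at h : C1_map M h -> forall x, sdiff_at h x.
Proof.
move=> [ch C1h] x; split=> [|c d Mc Md cx dx]; first exact: ch.
apply: (Ck1_sdiff _ (C1h c d Mc Md)).
apply: filterI; first exact: near_chart_img.
have := near_chart_inv cx (ch x _ (near_chart_dom dx)).
by apply: filterS.
Qed.

(** The identity read in two charts is a change of charts, so this is the compatibility of the
    atlas. It makes changes of tangent coordinates instances of the chain rule [jac_rep_comp]. *)
Lemma sdiff_at_id x : sdiff_at id x.
Proof.
split=> [|c d Mc Md cx dx]; first by apply: cvg_id.
have U := atlas_compatible Mc Md 1.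
apply: (Ck1_sdiff _ U).
apply: filterI; first exact: near_chart_img.
by have := near_chart_inv cx (near_chart_dom dx); apply: filterS.
Qed.

Lemma sdiff_rep_comp h h' c d e x : sdiff_at h x -> sdiff_at h' (h x) ->
  atlas M c -> atlas M d -> atlas M e ->
  chart_dom c x -> chart_dom d (h x) -> chart_dom e (h' (h x)) ->
  sdiff (rep c (h' \o h) e) (c x)
    (jac (rep c h d) (c x) *m jac (rep d h' e) (d (h x))).
Proof.
move=> [ch sh] [ch' sh'] Mc Md Me cx dx ex.
have rx : rep c h d (c x) = d (h x) by rewrite /rep /= chart_mapK.
have := sh c d Mc Md cx dx; have := sh' d e Md Me dx ex; rewrite -rx => s' s.
apply: sdiff_near (sdiff_comp s s').
have := near_chart_inv cx (ch _ (near_chart_dom dx)).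
by apply: filterS => y /= dy; rewrite /rep /= chart_mapK.
Qed.

Lemma jac_rep_comp h h' c d e x : sdiff_at h x -> sdiff_at h' (h x) ->
  atlas M c -> atlas M d -> atlas M e ->
  chart_dom c x -> chart_dom d (h x) -> chart_dom e (h' (h x)) ->
  jac (rep c (h' \o h) e) (c x) = jac (rep c h d) (c x) *m jac (rep d h' e) (d (h x)).
Proof.
by move=> hx h'x Mc Md Me cx dx ex; apply/sdiff_jac/sdiff_rep_comp.
Qed.

Lemma sdiff_at_comp h h' x : sdiff_at h x -> sdiff_at h' (h x) ->
  sdiff_at (h' \o h) x.
Proof.
move=> hx h'x; split=> [|c e Mc Me cx ex].
  by apply: continuous_comp; [exact: hx.1|exact: h'x.1].
rewrite (jac_rep_comp hx h'x Mc (chart_at_atlas M (h x)) Me cx (chart_at_dom M (h x)) ex).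
exact: (sdiff_rep_comp hx h'x Mc (chart_at_atlas M (h x)) Me cx (chart_at_dom M (h x)) ex).
Qed.

Lemma jac_rep_id c x : atlas M c -> chart_dom c x -> jac (rep c id c) (c x) = 1%:M.
Proof.
move=> Mc cx; apply: sdiff_jac; apply: sdiff_near (sdiff_id _).
by apply: filterS (near_chart_img cx) => y cy; rewrite /rep /= chart_invK.
Qed.

Local Notation ca := (chart_at M).
Local Notation Mca := (chart_at_atlas M).
Local Notation dca := (chart_at_dom M).

Definition tcoord_mx c x : mat := jac (rep (ca x) id c) (ca x x).

Lemma tcoordE c x (v : E) : tcoord M c x v = v *m tcoord_mx c x.
Proof. by rewrite mul_jac. Qed.

Lemma tcoord_mxK c x : atlas M c -> chart_dom c x ->
  tcoord_mx c x *m jac (rep c id (ca x)) (c x) = 1%:M.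
Proof.
move=> Mc cx; rewrite -(jac_rep_id (Mca x) (dca x)); apply/esym.
exact: (jac_rep_comp (sdiff_at_id x) (sdiff_at_id x) (Mca x) Mc (Mca x) (dca x) cx (dca x)).
Qed.

Lemma tcoord_mxVK c x : atlas M c -> chart_dom c x ->
  jac (rep c id (ca x)) (c x) *m tcoord_mx c x = 1%:M.
Proof. by move=> Mc cx; apply: mulmx1C; exact: tcoord_mxK. Qed.

Lemma tvecE c x (w : E) : chart_dom c x ->
  tvec M c (c x) w = w *m jac (rep c id (ca x)) (c x).
Proof. by move=> cx; rewrite mul_jac /tvec chart_mapK. Qed.

Definition tangent_mx h x : mat := jac (rep (ca x) h (ca (h x))) (ca x x).

Lemma tangent_diffE h x (v : E) : tangent_diff M h x v = v *m tangent_mx h x.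
Proof. by rewrite mul_jac. Qed.

(** Both sides are the Jacobian of [h] read from the preferred chart at [x] to [d]. *)
Lemma tangent_mx_tcoord h c d x : sdiff_at h x -> atlas M c -> atlas M d ->
  chart_dom c x -> chart_dom d (h x) ->
  tangent_mx h x *m tcoord_mx d (h x) = tcoord_mx c x *m jac (rep c h d) (c x).
Proof.
move=> hx Mc Md cx dx.
transitivity (jac (rep (ca x) h d) (ca x x)).
  exact/esym/(jac_rep_comp hx (sdiff_at_id (h x)) (Mca x) (Mca (h x)) Md (dca x) (dca (h x)) dx).
exact: (jac_rep_comp (sdiff_at_id x) hx (Mca x) Mc Md (dca x) cx dx).
Qed.

Lemma tangent_mx_comp h h' x : sdiff_at h x -> sdiff_at h' (h x) ->
  tangent_mx (h' \o h) x = tangent_mx h x *m tangent_mx h' (h x).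
Proof.
by move=> hx h'x; exact: (jac_rep_comp hx h'x (Mca x) (Mca (h x)) (Mca (h' (h x)))
  (dca x) (dca (h x)) (dca (h' (h x)))).
Qed.

Lemma sdiff_at_iter h k x : (forall y, sdiff_at h y) -> sdiff_at (iter k h) x.
Proof.
move=> hy; elim: k => [|k IHk]; first exact: sdiff_at_id.
exact: (sdiff_at_comp IHk (hy _)).
Qed.

Lemma iter_tangent_map h k x (v : E) : (forall y, sdiff_at h y) ->
  iter k (tangent_map M h) (x, v) = (iter k h x, v *m tangent_mx (iter k h) x).
Proof.
move=> hy; elim: k => [|k IHk].
  by rewrite [tangent_mx _ _](jac_rep_id (Mca x) (dca x)) mulmx1.
rewrite iterS IHk /tangent_map /= tangent_diffE.
rewrite (_ : iter k.+1 h = h \o iter k h)// tangent_mx_comp ?mulmxA//.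
exact: sdiff_at_iter.
Qed.

End ChartCalculus.

(** * The Riemannian norm in charts *)

Lemma cvg_mx (R : realType) (T : Type) (F : set_system T) (FF : Filter F) m n
    (A : T -> 'M[R]_(m, n)) (B : 'M[R]_(m, n)) :
  (forall i j, A t i j @[t --> F] --> B i j) -> A @ F --> B.
Proof.
move=> AB; apply/cvgrPdist_le => e e0.
have : \forall t \near F, forall ij : 'I_m * 'I_n, `|B ij.1 ij.2 - A t ij.1 ij.2| <= e.
  apply: (@filter_forall _ _ (fun (ij : 'I_m * 'I_n) t => `|B ij.1 ij.2 - A t ij.1 ij.2| <= e)).
  by move=> [i j] /=; have /cvgrPdist_le/(_ e e0) := AB i j.
apply: filterS => t At; apply: mx_norm_le; first exact: ltW.
by move=> i j; have := At (i, j); rewrite !mxE.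
Qed.

Lemma cvg_entry (R : realType) (T : Type) (F : set_system T) (FF : Filter F) m n
    (A : T -> 'M[R]_(m, n)) (B : 'M[R]_(m, n)) :
  A @ F --> B -> forall i j, A t i j @[t --> F] --> B i j.
Proof.
move=> AB i j; apply: (@cvg_comp _ _ _ A (fun M : 'M[R]_(m, n) => M i j) F (nbhs B)) => //.
exact: coord_continuous.
Qed.

Lemma cvg_mulmx (R : realType) (T : Type) (F : set_system T) (FF : Filter F) m n p
    (A : T -> 'M[R]_(m, n)) (A' : T -> 'M[R]_(n, p)) (B : 'M[R]_(m, n)) (B' : 'M[R]_(n, p)) :
  A @ F --> B -> A' @ F --> B' -> (fun t => A t *m A' t) @ F --> B *m B'.
Proof.
move=> AB AB'; apply: cvg_mx => i j.
under eq_fun do rewrite mxE; rewrite mxE.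
apply: cvg_big => [|k _]; first exact: add_continuous.
by apply: cvgM; exact: cvg_entry.
Qed.

Lemma cvg_trmx (R : realType) (T : Type) (F : set_system T) (FF : Filter F) m n
    (A : T -> 'M[R]_(m, n)) (B : 'M[R]_(m, n)) :
  A @ F --> B -> (fun t => (A t)^T) @ F --> B^T.
Proof.
by move=> AB; apply: cvg_mx => i j; under eq_fun do rewrite mxE; rewrite mxE; exact: cvg_entry.
Qed.

Section RiemannianNorm.
Variables (R : realType) (n : nat) (X : topologicalType) (M : smooth_manifold R n X)
  (G : riemannian_metric M).
Local Notation E := 'rV[R]_n.
Local Notation mat := 'M[R]_n.
Local Notation ca := (chart_at M).
Local Notation Mca := (chart_at_atlas M).
Local Notation dca := (chart_at_dom M).

(** The Gram matrix of the metric in the coordinates of [c]. In a fixed chart it is continuous in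
    [x], whereas [gram] refers to a preferred chart that may jump from point to point. *)
Definition gram_in (c : chart R n X) (x : X) : mat :=
  jac (rep c id (ca x)) (c x) *m gram G x *m (jac (rep c id (ca x)) (c x))^T.

Lemma gram_in_continuous c x : atlas M c -> chart_dom c x ->
  {for x, continuous (gram_in c)}.
Proof.
move=> Mc cx; apply: cvg_mx => i j.
pose f (y : E) : R := (tvec M c y (delta_mx 0 i) *m gram G (chart_inv c y)
  *m (tvec M c y (delta_mx 0 j))^T) 0 0.
have fE y : chart_dom c y -> gram_in c y i j = f (c y).
  move=> cy; rewrite /f !tvecE// chart_mapK// /gram_in.
  by rewrite trmx_mul !mulmxA -!mulmxA trmx_delta !mulmxA -colE -!mulmxA -rowE !mulmxA !mxE.
have cf : {for c x, continuous f}.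
  have h := @gram_smooth R n X M G c Mc (delta_mx 0 i) (delta_mx 0 j) 0%N (c x)
    (chart_map_img cx).
  exact: h.
have fc : (f \o c) y @[y --> x] --> gram_in c x i j.
  by rewrite fE//; apply: continuous_comp cf; exact: chart_map_continuous.
apply: cvg_trans fc; apply: near_eq_cvg.
by apply: filterS (near_chart_dom cx) => y cy; rewrite /= fE.
Qed.

Lemma tnorm_sq c x (v : E) : atlas M c -> chart_dom c x ->
  tnorm G (x, v) = Num.sqrt ((v *m tcoord_mx M c x *m gram_in c x *m
    (v *m tcoord_mx M c x)^T) 0 0).
Proof.
move=> Mc cx; rewrite /tnorm /gram_in /=; congr (Num.sqrt (fun_of_matrix _ 0 0)).
rewrite -[in LHS](mulmx1 v) -(tcoord_mxK Mc cx).
by rewrite -!mulmxA -!trmx_mul !mulmxA.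
Qed.

Lemma quad_le (A : mat) (w : E) : `|(w *m A *m w^T) 0 0| <= n%:R ^+ 2 * `|A| * `|w| ^+ 2.
Proof.
have wT : `|w^T| <= `|w|.
  by apply: mx_norm_le => // i j; rewrite mxE mx_entry_le.
rewrite (le_trans (mx_entry_le _ _ _))// (le_trans (norm_mulmx _ _))//.
have := norm_mulmx w A; set a := `|w *m A|; set b := `|w| in wT *; set k := `|A|.
move=> ab; have h : n%:R * a * `|w^T| <= n%:R * (n%:R * b * k) * b.
  by rewrite ler_pM ?mulr_ge0 ?normr_ge0// ler_wpM2l.
by apply: le_trans h _; rewrite le_eqVlt; apply/orP; left; apply/eqP; ring.
Qed.

(** The constant is the minimum of the quadratic form on the unit sphere, which is compact; in
    dimension 0 the sphere is empty and is treated apart. *)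
Lemma pos_def_lower (A : mat) : (forall w : E, w != 0 -> 0 < (w *m A *m w^T) 0 0) ->
  exists2 m : R, 0 < m & forall w : E, m * `|w| ^+ 2 <= (w *m A *m w^T) 0 0.
Proof.
move=> Apos; pose q (w : E) : R := (w *m A *m w^T) 0 0.
have cq : continuous q.
  move=> w; have FF := nbhs_filter (w : E).
  have idw : (fun x : E => x) @ nbhs w --> w by exact: cvg_id.
  have cA : (fun=> A) @ nbhs w --> A by exact: cvg_cst.
  exact: (cvg_entry FF (cvg_mulmx FF (cvg_mulmx FF idw cA) (cvg_trmx FF idw))).
pose S := [set w : E | `|w| = 1].
have qZ (k : R) w : q (k *: w) = k ^+ 2 * q w.
  by rewrite /q linearZ /= -!scalemxAl -scalemxAr scalerA !mxE expr2.
have q0 : q 0 = 0 by rewrite /q !mul0mx mxE.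
have [[w1 Sw1]|noS] := pselect (S !=set0); last first.
  exists 1 => // w; have [->|w0] := eqVneq w 0; first by rewrite normr0 expr0n mulr0 -/(q 0) q0.
  case: noS; exists (`|w|^-1 *: w); rewrite /S /= normrZ normfV normr_id mulVf//.
  by rewrite normr_eq0.
have cS : compact S.
  apply: bounded_closed_compact.
    by exists 1; split => // x x1 w /= ->; exact: ltW.
  apply: (@closed_comp _ _ (@normr R E) [set x | x = 1]); last exact: closed_eq.
  by move=> w _; exact: norm_continuous.
have [c cSc cmin] := @EVT_min_rV R n q S (ex_intro _ w1 Sw1) cS (continuous_subspaceT cq).
rewrite inE /S /= in cSc.
exists (q c); first by apply: Apos; rewrite -normr_eq0 cSc oner_neq0.
move=> w; rewrite -/(q w).
have [->|w0] := eqVneq w 0; first by rewrite normr0 expr0n mulr0 q0.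
have wE : w = `|w| *: (`|w|^-1 *: w) by rewrite scalerA divff ?normr_eq0// scale1r.
rewrite [in leRHS]wE qZ mulrC ler_wpM2l ?exprn_ge0//.
apply: cmin; rewrite inE /S /= normrZ normfV normr_id mulVf//.
by rewrite normr_eq0.
Qed.

(** If the form at [x0] is at least [m * |w| ^+ 2], a Gram matrix close to that of [x0] changes it
    by at most [m / 2 * |w| ^+ 2]. Half of the lower bound survives, and [a] includes the same
    margin for the upper bound. *)
Lemma tnorm_chart_equiv c x0 : atlas M c -> chart_dom c x0 ->
  exists2 K : R, 0 < K & \forall x \near x0, forall v : E,
    `|v *m tcoord_mx M c x| <= K * tnorm G (x, v) /\
    tnorm G (x, v) <= K * `|v *m tcoord_mx M c x|.
Proof.
move=> Mc cx0; pose q x (w : E) : R := (w *m gram_in c x *m w^T) 0 0.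
have [m m0 mq] : exists2 m : R, 0 < m & forall w : E, m * `|w| ^+ 2 <= q x0 w.
  apply: pos_def_lower => w w0; rewrite /gram_in.
  set J := jac _ _.
  have -> : w *m (J *m gram G x0 *m J^T) *m w^T = (w *m J) *m gram G x0 *m (w *m J)^T.
    by rewrite trmx_mul !mulmxA.
  apply: gram_pos; apply: contraNneq w0 => wJ.
  by rewrite -[w]mulmx1 -(tcoord_mxVK Mc cx0) mulmxA wJ mul0mx.
pose N2 : R := n%:R ^+ 2 + 1.
have N20 : 0 < N2 by rewrite ltr_wpDl// exprn_ge0.
pose a : R := N2 * (`|gram_in c x0| + 1) + m / 2.
have a0 : 0 < a by rewrite ltr_wpDl ?divr_gt0// mulr_ge0// ?ltW// ltr_wpDl.
pose K := Num.sqrt a + Num.sqrt (2 / m).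
have K0 : 0 < K by rewrite addr_gt0// sqrtr_gt0// divr_gt0.
have e0 : 0 < m / 2 / N2 by rewrite !divr_gt0.
exists K => //.
have /cvgrPdist_le/(_ _ e0) gc := gram_in_continuous Mc cx0.
near=> x => v.
have cx : chart_dom c x by near: x; exact: near_chart_dom.
have gx : `|gram_in c x0 - gram_in c x| <= m / 2 / N2 by near: x.
have qd w : `|q x0 w - q x w| <= m / 2 * `|w| ^+ 2.
  have -> : q x0 w - q x w = (w *m (gram_in c x0 - gram_in c x) *m w^T) 0 0.
    by rewrite mulmxBr mulmxBl /q !mxE.
  rewrite (le_trans (quad_le _ _))// ler_wpM2r ?exprn_ge0//.
  rewrite (le_trans (ler_wpM2l _ gx)) ?exprn_ge0//.
  by rewrite mulrCA ler_piMr ?divr_ge0 ?(ltW m0)// ler_pdivrMr// mul1r /N2 lerDl.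
rewrite (tnorm_sq _ Mc cx) -/(q x _); set w := v *m _.
have qx0 : q x0 w <= (a - m / 2) * `|w| ^+ 2.
  rewrite (le_trans (ler_norm _))// (le_trans (quad_le _ _))// ler_wpM2r ?exprn_ge0//.
  by rewrite /a addrK ler_pM ?exprn_ge0// /N2 lerDl.
have := qd w; rewrite ler_distl => /andP[qlo qhi].
have lo : m / 2 * `|w| ^+ 2 <= q x w by have := mq w; lra.
have hi : q x w <= a * `|w| ^+ 2 by lra.
have sqw : Num.sqrt (`|w| ^+ 2) = `|w| by rewrite sqrtr_sqr normr_id.
split.
  have : `|w| ^+ 2 <= 2 / m * q x w.
    have m2 : 0 <= 2 / m by rewrite divr_ge0// ltW.
    have := ler_wpM2l m2 lo; rewrite mulrA (_ : 2 / m * (m / 2) = 1) ?mul1r//.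
    by field; rewrite gt_eqF.
  move=> /ler_wsqrtr; rewrite sqw sqrtrM ?divr_ge0 ?(ltW m0)// => /le_trans; apply.
  by rewrite ler_wpM2r ?sqrtr_ge0// /K lerDr sqrtr_ge0.
move/ler_wsqrtr : hi; rewrite sqrtrM ?(ltW a0)// sqw => /le_trans; apply.
by rewrite ler_wpM2r// /K lerDl sqrtr_ge0.
Unshelve. all: by end_near. Qed.

End RiemannianNorm.

(** * Length and small balls *)

Section RealIntegral.
Variable R : realType.
Implicit Types (phi dphi L : R -> R) (a b u K : R).
Local Notation mu := (@lebesgue_measure R).

Lemma continuous_segment_integrable L a b :
  (forall t, a <= t <= b -> {for t, continuous L}) ->
  mu.-integrable `[a, b] (EFin \o L).
Proof.
move=> cL; apply: continuous_compact_integrable; first exact: segment_compact.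
apply: continuous_in_subspaceT => t; rewrite inE /= in_itv /=; exact: cL.
Qed.

Lemma increment_le_Rintegral phi dphi L a b K : a <= b ->
  (forall t, a <= t <= b -> is_derive t 1 phi (dphi t)) ->
  (forall t, a <= t <= b -> {for t, continuous dphi}) ->
  (forall t, {for t, continuous L}) ->
  (forall t, a <= t <= b -> `|dphi t| <= K * L t) ->
  `|phi b - phi a| <= K * (\int[mu]_(t in `[a, b]) L t)%R.
Proof.
rewrite le_eqVlt => /predU1P[<- _ _ _ _|ab dphiE cdphi cL dphiL].
  by rewrite set_itv1 Rintegral_set1 subrr normr0 mulr0.
have iL := @continuous_segment_integrable L a b (fun t _ => cL t).
have iphi := continuous_segment_integrable cdphi.
have cphi t : a <= t <= b -> {for t, continuous phi}.
  move=> /dphiE[dt _]; exact/differentiable_continuous/derivable1_diffP.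
have -> : phi b - phi a = (\int[mu]_(t in `[a, b]) dphi t)%R.
  rewrite /Rintegral (@continuous_FTC2 _ dphi phi)//.
  - apply: continuous_in_subspaceT => t; rewrite inE /= in_itv /=; exact: cdphi.
  - split.
    + by move=> t; rewrite in_itv /= => /andP[/ltW at' /ltW tb]; case: (dphiE t _); rewrite ?at'.
    + by apply: cvg_at_right_filter; apply: cphi; rewrite lexx ltW.
    + by apply: cvg_at_left_filter; apply: cphi; rewrite lexx ltW.
  - move=> t; rewrite in_itv /= => /andP[/ltW at' /ltW tb]; rewrite derive1E.
    by case: (dphiE t _); rewrite ?at'.
rewrite (le_trans (le_normr_Rintegral _ iphi))// -RintegralZl//.
apply: le_Rintegral => //.
- apply: (@continuous_segment_integrable (fun t => `|dphi t|)) => t tab.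
  by apply: continuous_comp; [exact: cdphi|exact: norm_continuous].
- apply: (@continuous_segment_integrable (fun t => K * L t)) => t _.
  by apply: cvgMr => //; exact: cL.
Qed.

Lemma Rintegral_subsegment L a u b : a <= u <= b ->
  (forall t, {for t, continuous L}) -> (forall t, 0 <= L t) ->
  (\int[mu]_(t in `[a, u]) L t <= \int[mu]_(t in `[a, b]) L t)%R.
Proof.
move=> /andP[au ub] cL L0; rewrite -subr_ge0.
rewrite (Rintegral_itvB (continuous_segment_integrable (fun t _ => cL t))) ?bnd_simp//.
exact: Rintegral_ge0.
Qed.

End RealIntegral.

HB.lock Definition cder (R : realType) n (X : topologicalType) (c : chart R n X)
  (gamma : R -> X) (t : R) : 'rV[R]_n := 'D_1 (c \o gamma : R^o -> 'rV[R]_n) t.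

Section Curves.
Variables (R : realType) (n : nat) (X : topologicalType) (M : smooth_manifold R n X)
  (G : riemannian_metric M).
Local Notation E := 'rV[R]_n.
Local Notation mat := 'M[R]_n.
Local Notation ca := (chart_at M).
Local Notation Mca := (chart_at_atlas M).
Local Notation dca := (chart_at_dom M).

Section OneCurve.
Variables (gamma : R -> X) (C1 : C1_curve M gamma).

Lemma curve_differentiable c t : atlas M c -> chart_dom c (gamma t) ->
  differentiable (c \o gamma : R^o -> E) t.
Proof. by move=> Mc ct; exact: ((C1.2 c Mc).1 t ct). Qed.

Lemma cder_continuous c t : atlas M c -> chart_dom c (gamma t) ->
  {for t, continuous (cder c gamma)}.
Proof.
move=> Mc ct; have := (C1.2 c Mc).2 1 t ct.
have -> : cder c gamma = (fun s : R^o => 'D_1 (c \o gamma : R^o -> E) s).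
  by apply/funext => s; rewrite cder.unlock.
exact.
Qed.

Lemma cder_is_derive c t k : atlas M c -> chart_dom c (gamma t) ->
  is_derive (t : R) 1 (fun s : R => (c (gamma s)) 0 k) (cder c gamma t 0 k).
Proof.
move=> Mc ct; have dl : derivable (c \o gamma : R^o -> E) t 1.
  exact/diff_derivable/curve_differentiable.
split; first exact: (derivable_mxP _ t 1).1 dl 0 k.
by rewrite cder.unlock derive_mx// mxE.
Qed.

Lemma velocity_tcoord c t : atlas M c -> chart_dom c (gamma t) ->
  velocity M gamma t *m tcoord_mx M c (gamma t) = cder c gamma t.
Proof.
move=> Mc ct; set d := ca (gamma t).
have dt : chart_dom d (gamma t) := dca (gamma t).
have [dF dFE] := sdiff_diff ((sdiff_at_id M (gamma t)).2 d c (Mca _) Mc dt ct).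
have db := curve_differentiable (Mca (gamma t)) dt.
pose F := rep d id c.
have cE : \forall s \near (t : R^o), (c \o gamma) s = (F \o (d \o gamma)) s.
  have := C1.1 t _ (near_chart_dom dt).
  apply: (@filterS _ _ (nbhs_filter (t : R^o))) => s ds.
  by rewrite /F /rep /= chart_mapK.
rewrite cder.unlock (near_eq_derive (1 : R^o) cE).
rewrite (deriveE _ (differentiable_comp db dF)) (diff_comp db dF) /= dFE /=.
by rewrite /velocity -/d (deriveE _ db).
Qed.

Definition speed (t : R) : R := tnorm G (gamma t, velocity M gamma t).

Lemma speed_ge0 t : 0 <= speed t. Proof. exact: sqrtr_ge0. Qed.

(** The preferred chart varies along the curve, so continuity is read off the expression of the
    speed in one fixed chart around [gamma t]. *)
Lemma speed_continuous t : {for t, continuous speed}.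
Proof.
pose c := ca (gamma t).
have Mc : atlas M c := Mca _; have ct : chart_dom c (gamma t) := dca _.
pose f s := Num.sqrt ((cder c gamma s *m gram_in G c (gamma s) *m (cder c gamma s)^T) 0 0).
have fE s : chart_dom c (gamma s) -> speed s = f s.
  by move=> cs; rewrite /speed (tnorm_sq G _ Mc cs) velocity_tcoord.
have FF := nbhs_filter t.
have cd := cder_continuous Mc ct.
have cg : (fun s => gram_in G c (gamma s)) @ t --> gram_in G c (gamma t).
  by apply: (continuous_comp (C1.1 t)); exact: gram_in_continuous.
have h := cvg_entry FF (cvg_mulmx FF (cvg_mulmx FF cd cg) (cvg_trmx FF cd)).
have cf : f @ t --> speed t.
  rewrite fE//; apply: (cvg_comp _ _ (h 0 0)); exact: sqrt_continuous.
apply: cvg_trans cf; apply: near_eq_cvg.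
have := C1.1 t _ (near_chart_dom ct); apply: (@filterS _ _ FF) => s cs.
by rewrite /= fE.
Qed.

Lemma curve_increment c a b K : atlas M c -> a <= b -> 0 <= K ->
  (forall t, a <= t <= b -> chart_dom c (gamma t) /\
    forall v : E, `|v *m tcoord_mx M c (gamma t)| <= K * tnorm G (gamma t, v)) ->
  `|c (gamma b) - c (gamma a)| <= K * arc_length G gamma a b.
Proof.
move=> Mc ab K0 tK; apply: mx_norm_le => [|i k].
  by rewrite mulr_ge0// Rintegral_ge0// => t _; exact: speed_ge0.
rewrite {i}ord1 mxE [X in _ + X]mxE.
apply: (@increment_le_Rintegral _ (fun s => c (gamma s) 0 k) (fun s => cder c gamma s 0 k)) => //.
- by move=> t /tK[ct _]; exact: cder_is_derive.
- move=> t /tK[ct _]; exact: (cvg_entry (nbhs_filter t) (cder_continuous Mc ct)).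
- exact: speed_continuous.
move=> t /tK[ct ctK]; rewrite (le_trans (mx_entry_le _ _ _))//.
by rewrite -velocity_tcoord.
Qed.

End OneCurve.
End Curves.

Section SmallBalls.
Variables (R : realType) (n : nat) (X : topologicalType) (M : smooth_manifold R n X)
  (G : riemannian_metric M).
Local Notation E := 'rV[R]_n.

Definition chart_cball (c : chart R n X) (a : E) (r : R) : set X :=
  [set x | chart_dom c x /\ `|c x - a| <= r].

(** The set is the image of a compact Euclidean ball under the inverse chart, hence compact, and [X]
    is Hausdorff. *)
Lemma chart_cball_closed c a r : (forall w, `|w - a| <= r -> chart_img c w) ->
  closed (chart_cball c a r).
Proof.
move=> aimg; have -> : chart_cball c a r = chart_inv c @` [set w | `|w - a| <= r].
  apply/seteqP; split=> [x [cx xr]|_ [w wr <-]].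
    by exists (c x) => //; exact: chart_mapK.
  by split; [exact: chart_inv_dom (aimg _ wr)|rewrite (chart_invK (aimg _ wr))].
apply: compact_closed; first exact: manifold_hausdorff M.
apply: continuous_compact.
  apply: continuous_in_subspaceT => w; rewrite inE /= => /aimg wc.
  exact: chart_inv_continuous.
apply: bounded_closed_compact.
  exists (r + `|a|); split; first exact: num_real.
  move=> x rx w /= wr; rewrite -(subrK a w) (le_trans (ler_normD _ _))//.
  by rewrite (le_trans _ (ltW rx))// lerD2r.
apply: (@closed_comp _ _ (fun w : E => `|w - a|) [set x | x <= r]); last exact: closed_le.
move=> w _; apply: continuous_comp; last exact: norm_continuous.
have idw : (fun x : E => x) @ nbhs w --> w by exact: cvg_id.
exact: (cvgB idw (cvg_cst a)).
Qed.

Lemma near_chart_cball c x (S : set X) : chart_dom c x -> nbhs x S ->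
  exists2 r : R, 0 < r & (forall w, `|w - c x| <= r -> chart_img c w) /\
    forall y, chart_cball c (c x) r y -> S y.
Proof.
move=> cx xS.
have /nbhs_norm_le[r r0 rP] : \forall w \near c x, chart_img c w /\ S (chart_inv c w).
  by apply: filterI; [exact: near_chart_img|exact: near_chart_inv].
exists r => //; split=> [w /rP[]//|y [cy /rP[_]]].
by rewrite chart_mapK.
Qed.

Lemma chart_cball_nbhs c x r : 0 < r -> chart_dom c x -> nbhs x (chart_cball c (c x) r).
Proof.
move=> r0 cx; apply: filterI; first exact: near_chart_dom.
apply: (near_chart_map cx (S := [set w | `|w - c x| <= r])).
by apply/nbhs_norm_le; exists r.
Qed.

Section OneChart.
Variables (c : chart R n X) (a0 : E) (r K : R).
Hypotheses (Mc : atlas M c) (K0 : 0 <= K)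
  (rimg : forall w, `|w - a0| <= r -> chart_img c w)
  (rK : forall x, chart_cball c a0 r x -> forall v : E,
    `|v *m tcoord_mx M c x| <= K * tnorm G (x, v)).

(** While the curve is in the ball of radius [r], where the norms are comparable, its coordinates
    move by at most [K] times its length. This confines it to the smaller ball of radius [rho < r],
    so it can never reach the boundary of the larger one. *)
Lemma curve_stays gamma a b : C1_curve M gamma -> a <= b ->
  chart_dom c (gamma a) -> `|c (gamma a) - a0| + K * arc_length G gamma a b < r ->
  chart_dom c (gamma b) /\
  `|c (gamma b) - c (gamma a)| <= K * arc_length G gamma a b.
Proof.
move=> C1 ab ca; set l := arc_length G gamma a b; set rho := _ + _ => rhor.
have l0 : 0 <= l by apply: Rintegral_ge0 => t _; exact: speed_ge0.
pose B := chart_cball c a0 rho.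
have Br : B `<=` chart_cball c a0 r.
  by move=> x [cx xr]; split => //; exact: le_trans xr (ltW rhor).
have cB : closed B.
  by apply: chart_cball_closed => w wr; apply: rimg; exact: le_trans wr (ltW rhor).
have inc u : a <= u <= b -> (forall t, a <= t <= u -> chart_cball c a0 r (gamma t)) ->
    `|c (gamma u) - c (gamma a)| <= K * l.
  move=> /andP[au ub] uB.
  apply: le_trans (_ : _ <= K * arc_length G gamma a u) _.
    apply: (curve_increment C1) => // t tau; split; first by case: (uB t tau).
    exact/rK/uB.
  rewrite ler_wpM2l//; apply: (@Rintegral_subsegment _ (speed G gamma)) => //.
  - by rewrite au.
  - exact: speed_continuous.
  - exact: speed_ge0.
have incB u : a <= u <= b -> (forall t, a <= t <= u -> chart_cball c a0 r (gamma t)) ->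
    B (gamma u).
  move=> aub uB; split.
    by have [] // := uB u; rewrite lexx andbT; case/andP: aub.
  rewrite -(subrKA (c (gamma a))) (le_trans (ler_normD _ _))// addrC lerD//.
  exact: inc.
(* The last time [s] up to which the curve has stayed in the closed set [B]
   cannot precede [b], as [B] is interior to the larger ball. *)
pose S := [set u | a <= u <= b /\ forall t, a <= t <= u -> B (gamma t)].
have Sa : S a.
  split=> [|t]; first by rewrite lexx.
  by rewrite -eq_le => /eqP <-; split => //; rewrite /rho lerDl mulr_ge0.
have supS : has_sup S by split; [exists a|exists b => u [/andP[]]].
pose s := sup S.
have as_ : a <= s by apply: (sup_upper_bound supS).
have sb : s <= b by apply: ge_sup; [exists a|move=> u [/andP[]]].
have ltsB t : a <= t -> t < s -> B (gamma t).
  move=> at_ ts; have st0 : 0 < s - t by rewrite subr_gt0.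
  have [u [_ uB] tu] := sup_adherent st0 supS.
  by apply: uB; rewrite at_ ltW//; move: tu; rewrite subKr.
have sB : B (gamma s).
  have [<-|as0] := eqVneq a s; first by case: Sa => _; apply; rewrite lexx.
  have {as0}as0 : a < s by rewrite lt_neqAle as0.
  apply: (closed_cvg _ cB _ _ (cvg_at_left_filter (C1.1 s))).
  near=> t; apply: ltsB; last by near: t; exact: nbhs_left_lt.
  by apply/ltW; near: t; exact: nbhs_left_gt.
have Ss : S s.
  split=> [|t /andP[at_]]; first by rewrite as_.
  by rewrite le_eqVlt => /predU1P[->//|]; exact: ltsB.
have [sb_eq|sb_neq] := eqVneq s b.
  split; first by rewrite -sb_eq; case: sB.
  apply: inc => [|t atb]; first by rewrite ab lexx.
  by apply: Br; apply: Ss.2; rewrite sb_eq.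
have {sb_neq}sb' : s < b by rewrite lt_neqAle sb_neq.
have /C1.1/nbhs_norm_le[d /= d0 dB] : nbhs (gamma s) (chart_cball c a0 r).
  have [cs sr] := sB.
  apply: filterI; first exact: near_chart_dom.
  apply: (near_chart_map cs (S := [set w | `|w - a0| <= r])).
  apply/nbhs_norm_le; exists (r - rho); first by rewrite subr_gt0.
  move=> w wr /=; rewrite -(subrKA (c (gamma s))) (le_trans (ler_normD _ _))//.
  by rewrite -[leRHS](subrK rho) lerD.
pose u := minr b (s + d).
have su : s < u by rewrite lt_min sb' ltrDl.
suff /(sup_upper_bound supS) : S u by rewrite leNgt -/s su.
have uB t : a <= t <= u -> chart_cball c a0 r (gamma t).
  move=> /andP[at_ tu]; have [ts|st] := leP t s.
    by apply: Br; apply: Ss.2; rewrite at_.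
  apply: dB; rewrite ger0_norm ?subr_ge0 ?(ltW st)// lerBlDl.
  by rewrite (le_trans tu)// ge_min lexx orbT.
have ub : u <= b by rewrite ge_min lexx.
split=> [|t /andP[at_ tu]]; first by rewrite ub (le_trans as_ (ltW su)).
apply: incB => [|t' /andP[at' t't]]; first by rewrite at_ (le_trans tu).
by apply: uB; rewrite at' (le_trans t't).
Unshelve. all: by end_near. Qed.

Lemma joined_ge0 x y L : joined G x y L -> 0 <= L.
Proof.
elim=> // gamma a b z L' _ _ _ IH; rewrite addr_ge0//.
by apply: Rintegral_ge0 => t _; exact: speed_ge0.
Qed.

Lemma joined_stays x y L : joined G x y L -> chart_dom c x ->
  `|c x - a0| + K * L < r -> chart_dom c y /\ `|c y - c x| <= K * L.
Proof.
elim=> [z cz _|gamma a b z L' C1 ab bz IH ca].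
  by rewrite subrr normr0 mulr0.
rewrite mulrDr addrA => lr.
have KL' : 0 <= K * L' by rewrite mulr_ge0// (joined_ge0 bz).
have lr' : `|c (gamma a) - a0| + K * arc_length G gamma a b < r.
  by apply: le_lt_trans lr; rewrite lerDl.
have [cb bl] := curve_stays C1 ab ca lr'.
have [||cz zl] := IH => //.
  have := ler_distD (c (gamma a)) (c (gamma b)) a0; lra.
split=> //; have := ler_distD (c (gamma b)) (c z) (c (gamma a)); lra.
Qed.

End OneChart.

(** Small Riemannian balls are small for the topology, with one radius for all centers near [x0]. A
    center within [r / 4] in coordinates and a displacement below [r / 2] stay inside the ball of
    radius [r]. *)
Lemma rball_near (x0 : X) (S : set X) : nbhs x0 S ->
  exists2 e : R, 0 < e & \forall x \near x0, rball G x e `<=` S.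
Proof.
move=> x0S; pose c := chart_at M x0.
have Mc : atlas M c := chart_at_atlas M x0.
have cx0 : chart_dom c x0 := chart_at_dom M x0.
have [K K0 KP] := tnorm_chart_equiv G Mc cx0.
have /(near_chart_cball cx0)[r r0 [rimg rS]] :
    \forall x \near x0, S x /\ forall v : E, `|v *m tcoord_mx M c x| <= K * tnorm G (x, v).
  by apply: filterI => //; apply: filterS KP => x xv v; have [] := xv v.
exists (r / 2 / K); first by rewrite !divr_gt0.
have r20 : 0 < r / 4 by rewrite divr_gt0.
apply: filterS (chart_cball_nbhs r20 cx0) => x [cx xr] z.
rewrite /rball /= /rdist => /ereal_inf_lt[_ [L xzL <-]]; rewrite lte_fin => Lr.
have KL : K * L < r / 2 by rewrite mulrC -ltr_pdivlMr.
have rK y : chart_cball c (c x0) r y -> forall v : E,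
    `|v *m tcoord_mx M c y| <= K * tnorm G (y, v).
  by move=> /rS[].
have [|cz zl] := joined_stays Mc (ltW K0) rimg rK xzL cx; first by lra.
apply: (rS z _).1; split => //.
have := ler_distD (c x) (c z) (c x0); lra.
Qed.

End SmallBalls.

(** * The hyperbolic splitting in charts *)

(** When [1 - A] is small, [A] has trivial kernel, and its inverse [B] satisfies
    [1 - B = - B (1 - A)]. With [|B| <= 1 + |1 - B|], the term in [|1 - B|] on the right has factor
    at most 1/4 and is absorbed. *)
Lemma cvg_invmx1 (R : realType) (T : Type) (F : set_system T) (FF : Filter F) n
    (A : T -> 'M[R]_n) : A @ F --> (1%:M : 'M[R]_n) ->
  (\forall t \near F, A t \in unitmx) /\ (fun t => invmx (A t)) @ F --> (1%:M : 'M[R]_n).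
Proof.
move=> /cvgrPdist_le A1; pose N : R := 2 * n%:R + 1.
have N0 : 0 < N by rewrite ltr_wpDl// mulr_ge0.
have near_unit (e : R) : 0 < e -> e <= 1 -> \forall t \near F,
    A t \in unitmx /\ `|1%:M - invmx (A t)| <= e.
  move=> e0 e1; have eN : 0 < e / N / 2 by rewrite !divr_gt0.
  have := A1 _ eN; apply: filterS => t At.
  have nA : 2 * (n%:R * `|1%:M - A t|) <= e / 2.
    have h : N * `|1%:M - A t| <= N * (e / N / 2) by rewrite ler_wpM2l// ltW.
    have eq : N * (e / N / 2) = e / 2 by field; rewrite gt_eqF.
    rewrite eq in h; apply: le_trans h; rewrite mulrA ler_wpM2r// /N lerDl//.
  have Au : A t \in unitmx.
    rewrite -row_free_unit -kermx_eq0; apply/eqP/row_matrixP => i; rewrite row0.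
    set v := row i _; have vA : v *m A t = 0.
      by rewrite /v -row_mul mulmx_ker row0.
    have vle : `|v| <= 1/2 * `|v|.
      have := opbP (1%:M - A t) v; rewrite mulmxBr vA mulmx1 subr0.
      move=> /le_trans; apply; rewrite ler_wpM2r//; lra.
    by apply/eqP; rewrite -normr_le0; lra.
  split => //; set B := invmx (A t).
  have BA : 1%:M - B = - (B *m (1%:M - A t)) by rewrite mulmxBr mulmx1 mulVmx// opprB.
  have B1 : `|1%:M - B| <= n%:R * `|B| * `|1%:M - A t| by rewrite BA normrN norm_mulmx.
  have one : `|1%:M : 'M[R]_n| <= 1.
    by apply: mx_norm_le => // i j; rewrite mxE; case: (_ == _); rewrite ?normr1 ?normr0.
  have Bt : `|B| <= 1 + `|1%:M - B|.
    by rewrite -{1}[B](subKr 1%:M) (le_trans (ler_normB _ _))// lerD.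
  have h : n%:R * `|B| * `|1%:M - A t| <= n%:R * `|1%:M - A t| + n%:R * `|1%:M - A t| * `|1%:M - B|.
    have a0 : 0 <= n%:R * `|1%:M - A t| by rewrite mulr_ge0.
    by have := ler_wpM2l a0 Bt; rewrite mulrDr mulr1 mulrAC.
  have h2 : n%:R * `|1%:M - A t| * `|1%:M - B| <= 1 / 4 * `|1%:M - B|.
    by rewrite ler_wpM2r//; lra.
  have p0 := normr_ge0 (1%:M - B); lra.
split.
  by have := near_unit 1 ltr01 (lexx _); apply: filterS => t [].
apply/cvgrPdist_le => e e0.
have m0 : 0 < minr e 1 by rewrite lt_min e0 ltr01.
have m1 : minr e 1 <= 1 by rewrite ge_min lexx orbT.
have := near_unit _ m0 m1; apply: filterS => t [_]; rewrite le_min.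
by case/andP.
Qed.

(* The projection onto [Es x] along [Eu x], acting on coordinate row vectors in
   the chart [c]. *)
HB.lock Definition split_mx (R : realType) n (X : topologicalType)
    (M : smooth_manifold R n X) (Es Eu : X -> {vspace 'rV[R]_n}) (c : chart R n X) (x : X) :
    'M[R]_n :=
  jac (rep c id (chart_at M x)) (c x) *m lin1_mx (daddv_pi (Es x) (Eu x)) *m tcoord_mx M c x.

Section Splitting.
Variables (R : realType) (n : nat) (X : topologicalType) (M : smooth_manifold R n X).
Local Notation E := 'rV[R]_n.
Local Notation mat := 'M[R]_n.
Variables (Es Eu : X -> {vspace E}).
Hypothesis split : forall x, (Es x + Eu x = fullv)%VS /\ (Es x :&: Eu x = 0)%VS.

Lemma split_mem x (v : E) : exists s u : E, [/\ s \in Es x, u \in Eu x & v = s + u].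
Proof.
have : v \in (Es x + Eu x)%VS by rewrite (split x).1 memvf.
by move=> /memv_addP[s Ss [u Uu ->]]; exists s, u.
Qed.

Section AtPoint.
Variables (c : chart R n X) (x : X).
Hypotheses (Mc : atlas M c) (cx : chart_dom c x).
Local Notation J := (tcoord_mx M c x).
Local Notation P := (split_mx M Es Eu c x).

Lemma split_mxS (v : E) : v \in Es x -> v *m J *m P = v *m J.
Proof.
move=> vs; rewrite split_mx.unlock !mulmxA -[v *m _ *m _]mulmxA tcoord_mxK// mulmx1.
by rewrite mul_rV_lin1 /= daddv_pi_id ?(split x).2.
Qed.

Lemma split_mxU (v : E) : v \in Eu x -> v *m J *m P = 0.
Proof.
move=> vu; rewrite split_mx.unlock !mulmxA -[v *m _ *m _]mulmxA tcoord_mxK// mulmx1.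
rewrite mul_rV_lin1 /= (_ : daddv_pi _ _ _ = 0) ?mul0mx//.
have h1 : daddv_pi (Eu x) (Es x) v = v.
  by apply: daddv_pi_id => //; rewrite capvC; exact: (split x).2.
have h2 : daddv_pi (Es x) (Eu x) v + daddv_pi (Eu x) (Es x) v = v.
  by apply: daddv_pi_add; [exact: (split x).2|rewrite (split x).1 memvf].
by apply: (addIr v); rewrite add0r -[X in _ + X]h1 h2.
Qed.

Lemma split_mx_im (w : E) : exists2 s : E, s \in Es x & w *m P = s *m J.
Proof.
exists (daddv_pi (Es x) (Eu x) (w *m jac (rep c id (chart_at M x)) (c x))).
  exact: memv_pi.
by rewrite split_mx.unlock !mulmxA mul_rV_lin1.
Qed.

Lemma split_mx_ker (w : E) : exists2 u : E, u \in Eu x & w *m (1%:M - P) = u *m J.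
Proof.
have [s [u [ss uu wE]]] := split_mem x (w *m jac (rep c id (chart_at M x)) (c x)).
exists u => //; rewrite mulmxBr mulmx1.
have -> : w = s *m J + u *m J by rewrite -mulmxDl -wE -mulmxA tcoord_mxVK ?mulmx1.
by rewrite mulmxDl split_mxS// split_mxU// addr0 addrC addKr.
Qed.

Lemma split_mx_idem : P *m P = P.
Proof.
apply/row_matrixP => i; rewrite row_mul rowE.
by have [s ss ->] := split_mx_im (delta_mx 0 i); rewrite split_mxS.
Qed.

End AtPoint.

Lemma split_mx_continuous c x0 : atlas M c -> chart_dom c x0 ->
  continuous_subbundle M Es -> continuous_subbundle M Eu ->
  {for x0, continuous (split_mx M Es Eu c)}.
Proof.
move=> Mc cx0 /(_ x0)[k [s sP]] /(_ x0)[l [u uP]].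
(* With [T] the matrix of a frame adapted to the splitting, [T *m P = D *m T];
   a left inverse [L] of [T x0] makes [L *m T] invertible near [x0]. *)
pose T x : 'M[R]_(k + l, n) := col_mx (\matrix_(i < k) (s i x *m tcoord_mx M c x))
                                      (\matrix_(i < l) (u i x *m tcoord_mx M c x)).
pose D : 'M[R]_(k + l) := block_mx 1%:M 0 0 0.
have TD x : chart_dom c x -> (forall i, s i x \in Es x) -> (forall i, u i x \in Eu x) ->
    T x *m split_mx M Es Eu c x = D *m T x.
  move=> cx sx ux; rewrite mul_col_mx mul_block_col !mul0mx mul1mx !addr0.
  congr col_mx; apply/row_matrixP => i; rewrite row_mul ?row0 !rowK.
    by rewrite split_mxS.
  by rewrite split_mxU.
have basis_in x m (v : 'I_m -> X -> E) (F : X -> {vspace E}) :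
    basis_of (F x) [tuple v i x | i < m] -> forall i, v i x \in F x.
  by move=> vb i; apply: (basis_mem vb); apply/tnthP; exists i; rewrite tnth_mktuple.
have [sb0 sc0] := nbhs_singleton sP; have [ub0 uc0] := nbhs_singleton uP.
have cT : T @ x0 --> T x0.
  apply: cvg_mx => i j; rewrite /T.
  have ce m (v : 'I_m -> X -> E) i' : continuous_vfield_at M (v i') x0 ->
      (v i' x *m tcoord_mx M c x) 0 j @[x --> x0] --> (v i' x0 *m tcoord_mx M c x0) 0 j.
    move=> /(_ c Mc cx0) cv.
    have {}cv : (fun x => v i' x *m tcoord_mx M c x) @ x0 --> v i' x0 *m tcoord_mx M c x0.
      have e : (fun x => v i' x *m tcoord_mx M c x) = (fun x => tcoord M c x (v i' x)).
        by apply/funext => x; rewrite tcoordE.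
      by rewrite e -tcoordE; exact: cv.
    exact: (cvg_entry (nbhs_filter x0) cv).
  case: (split_ordP i) => i' ->.
    by under eq_fun do rewrite col_mxEu mxE; rewrite col_mxEu mxE; exact: ce.
  by under eq_fun do rewrite col_mxEd mxE; rewrite col_mxEd mxE; exact: ce.
have full : (1%:M <= T x0)%MS.
  apply/row_subP => i; rewrite rowE mulmx1; set e : E := delta_mx 0 i.
  have span m (v : 'I_m -> X -> E) (F : X -> {vspace E}) (S : 'M[R]_(m, n)) (w : E) :
      basis_of (F x0) [tuple v i x0 | i < m] -> w \in F x0 ->
      S = \matrix_(i < m) (v i x0 *m tcoord_mx M c x0) -> (w *m tcoord_mx M c x0 <= S)%MS.
    move=> vb wF ->; rewrite (coord_basis vb wF) mulmx_suml.
    apply: summx_sub => i' _; rewrite -scalemxAl scalemx_sub//.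
    rewrite (nth_map i') ?size_enum_ord// nth_ord_enum.
    by have := row_sub i' (\matrix_(i < m) (v i x0 *m tcoord_mx M c x0)); rewrite rowK.
  have [w [z [ws zu wz]]] := split_mem x0 (e *m jac (rep c id (chart_at M x0)) (c x0)).
  have -> : e = w *m tcoord_mx M c x0 + z *m tcoord_mx M c x0.
    by rewrite -mulmxDl -wz -mulmxA tcoord_mxVK ?mulmx1.
  rewrite -addsmxE; apply: addmx_sub_adds; [exact: span sb0 ws _|exact: span ub0 zu _].
pose L : 'M[R]_(n, k + l) := pinvmx (T x0).
have LT : L *m T x0 = 1%:M by have := mulmxKpV full; rewrite mul1mx.
have FF := nbhs_filter x0.
have cL : (fun=> L) @ x0 --> L by exact: cvg_cst.
have cD : (fun=> D) @ x0 --> D by exact: cvg_cst.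
have cA := cvg_mulmx FF cL cT; rewrite LT in cA.
have [uA iA] := cvg_invmx1 FF cA.
(* Multiplying [T *m P = D *m T] by [L] gives [P = (L T)^-1 L D T] wherever [L T] is invertible, and
   the right-hand side is continuous at [x0]. *)
have cP := cvg_mulmx FF iA (cvg_mulmx FF cL (cvg_mulmx FF cD cT)).
have e0 : 1%:M *m (L *m (D *m T x0)) = split_mx M Es Eu c x0.
  by rewrite mul1mx -(TD x0 cx0 (basis_in _ _ _ _ sb0) (basis_in _ _ _ _ ub0)) mulmxA LT mul1mx.
rewrite e0 in cP; apply: cvg_trans cP; apply: near_eq_cvg.
near=> x; have cx : chart_dom c x by near: x; exact: near_chart_dom.
have [sbx _] : basis_of (Es x) [tuple s i x | i < k] /\
    forall i, continuous_vfield_at M (s i) x by near: x.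
have [ubx _] : basis_of (Eu x) [tuple u i x | i < l] /\
    forall i, continuous_vfield_at M (u i) x by near: x.
have Au : L *m T x \in unitmx by near: x.
rewrite -(TD x cx (basis_in _ _ _ _ sbx) (basis_in _ _ _ _ ubx)).
by rewrite (mulmxA L) mulKmx.
Unshelve. all: by end_near. Qed.

End Splitting.

Section InvariantSplitting.
Variables (R : realType) (n : nat) (X : topologicalType) (M : smooth_manifold R n X)
  (G : riemannian_metric M).
Local Notation E := 'rV[R]_n.
Local Notation mat := 'M[R]_n.

(** Stable means mapped into itself by the tangent map, not contracted: it is meant for [Es] and
    [Eu] alike. *)
Definition stable (h : X -> X) (F : X -> {vspace E}) :=
  forall x (v : E), v \in F x -> v *m tangent_mx M h x \in F (h x).

Lemma stable_iter h F k : (forall x, sdiff_at M h x) -> stable h F ->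
  stable (iter k h) F.
Proof.
move=> sh hF; elim: k => [|k IHk] x v vF.
  by rewrite [tangent_mx _ _ _](jac_rep_id (chart_at_atlas M x) (chart_at_dom M x)) mulmx1.
rewrite (tangent_mx_comp (h := iter k h) (h' := h)) ?mulmxA//; last exact: sdiff_at_iter.
by apply: hF; exact: IHk.
Qed.

Lemma invariant_stable f F : invariant_subbundle M f F -> stable f F.
Proof.
move=> fF x v vF; rewrite -tangent_diffE.
have : [set` F (f x)] (tangent_diff M f x v) by rewrite -fF; exists v.
by [].
Qed.

Lemma tangent_mx_cancel f g x : cancel f g -> sdiff_at M f x -> sdiff_at M g (f x) ->
  tangent_mx M f x *m tangent_mx M g (f x) = 1%:M.
Proof.
move=> fg sf sg.
have -> : 1%:M = tangent_mx M id x.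
  by rewrite [RHS](jac_rep_id (chart_at_atlas M x) (chart_at_dom M x)).
rewrite -tangent_mx_comp// (_ : g \o f = id)//.
by apply/funext => y; exact: fg.
Qed.

(** Uses the surjectivity contained in invariance: a vector of [F x] is the image of a vector of
    [F (g x)], to which the differential of [g] brings it back. *)
Lemma invariant_stable_inv f g F : cancel f g -> cancel g f ->
  (forall x, sdiff_at M f x) -> (forall x, sdiff_at M g x) ->
  invariant_subbundle M f F -> stable g F.
Proof.
move=> fg gf sf sg fF x v vF.
have : [set` F (f (g x))] v by rewrite gf.
rewrite -fF => -[u /= uF <-]; rewrite tangent_diffE -mulmxA.
have := tangent_mx_cancel fg (sf (g x)) (sg (f (g x))); rewrite gf => ->.
by rewrite mulmx1.
Qed.

Variables (Es Eu : X -> {vspace E}).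
Hypothesis split : forall x, (Es x + Eu x = fullv)%VS /\ (Es x :&: Eu x = 0)%VS.
Local Notation P := (split_mx M Es Eu).

Section OneMap.
Variables (h : X -> X) (c d : chart R n X) (x : X).
Hypotheses (sh : sdiff_at M h x) (Mc : atlas M c) (Md : atlas M d)
  (cx : chart_dom c x) (dx : chart_dom d (h x)).
Local Notation D := (jac (rep c h d) (c x)).

(** This lemma and the next three express that [D] is block diagonal for the splittings at [x] and
    [h x]. Near this pair the off-diagonal blocks become small instead of zero. *)
Lemma stable_mulS : stable h Es -> P c x *m D *m P d (h x) = P c x *m D.
Proof.
move=> hS; apply: eq_mulmx => w; rewrite !mulmxA.
have [s ss ->] := split_mx_im M Es Eu c x w.
by rewrite -[s *m _ *m D]mulmxA -(tangent_mx_tcoord sh Mc Md cx dx) mulmxA split_mxS// hS.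
Qed.

Lemma stable_mulU : stable h Eu -> (1%:M - P c x) *m D *m P d (h x) = 0.
Proof.
move=> hU; apply: eq_mulmx => w; rewrite !mulmxA mulmx0.
have [u uu ->] := split_mx_ker split Mc cx w.
by rewrite -[u *m _ *m D]mulmxA -(tangent_mx_tcoord sh Mc Md cx dx) mulmxA split_mxU// hU.
Qed.

Lemma stable_mulSU : stable h Es -> P c x *m D *m (1%:M - P d (h x)) = 0.
Proof. by move=> hS; rewrite mulmxBr mulmx1 stable_mulS// subrr. Qed.

Lemma stable_mulUU : stable h Eu ->
  (1%:M - P c x) *m D *m (1%:M - P d (h x)) = (1%:M - P c x) *m D.
Proof. by move=> hU; rewrite mulmxBr mulmx1 stable_mulU// subr0. Qed.

(** The three factors [K] are the norm of the projection, the passage from coordinates to the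
    Riemannian norm at [x], and the passage back at [h x]. *)
Lemma contracted_opb (F : X -> {vspace E}) (Q : mat) (K l : R) : 0 <= K -> 0 <= l ->
  (forall w : E, exists2 s : E, s \in F x & w *m Q = s *m tcoord_mx M c x) ->
  (forall s : E, s \in F x -> tnorm G (h x, s *m tangent_mx M h x) <= l * tnorm G (x, s)) ->
  (forall v : E, `|v *m tcoord_mx M d (h x)| <= K * tnorm G (h x, v)) ->
  (forall v : E, tnorm G (x, v) <= K * `|v *m tcoord_mx M c x|) ->
  opb Q K -> opb (Q *m D) (K ^+ 3 * l).
Proof.
move=> K0 l0 QF Fl Kd Kc QK w; rewrite mulmxA; have [s sF sE] := QF w.
rewrite sE -mulmxA -(tangent_mx_tcoord sh Mc Md cx dx) mulmxA (le_trans (Kd _))//.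
have h1 := ler_wpM2l K0 (Fl s sF).
have h2 := ler_wpM2l (mulr_ge0 K0 l0) (Kc s).
have h3 : K * l * K * `|s *m tcoord_mx M c x| <= K * l * K * (K * `|w|).
  by rewrite -sE ler_wpM2l// !mulr_ge0.
apply: le_trans h1 _; rewrite mulrA; apply: le_trans h2 _; rewrite mulrA.
by apply: le_trans h3 _; rewrite le_eqVlt; apply/orP; left; apply/eqP; ring.
Qed.

End OneMap.
End InvariantSplitting.

(** * Uniformity over a finite atlas *)

Lemma near_uniform (X : topologicalType) (T : Type) (F : set_system T) (FF : Filter F)
    (B : set X) (P : T -> X -> Prop) : compact B ->
  (forall x, B x -> exists2 S : set X, nbhs x S &
     \forall t \near F, forall y, S y -> B y -> P t y) ->
  \forall t \near F, forall y, B y -> P t y.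
Proof.
move=> /compact_near_coveringP cB loc.
have := cB T F (fun t y => B y -> P t y) FF.
have H : forall x, B x -> \forall y \near x & t \near F, B y -> P t y.
  move=> x /loc[S xS tP].
  exists (S, [set t | forall y, S y -> B y -> P t y]) => //=.
  by move=> [y t] /= [Sy tS]; exact: tS.
by move=> /(_ H); apply: filterS => t tP y By; exact: tP.
Qed.

(** The near-covering form of compactness, for the filter on sequences generated by those containing
    given points: each point is covered once its center has been listed. *)
Lemma compact_finite_cover (X : topologicalType) (A : set X) (B : X -> set X) :
  compact A -> (forall x, A x -> nbhs x (B x)) ->
  exists s : seq X, forall x, A x -> exists2 y, y \in s & B y x.
Proof.
move=> /compact_near_coveringP cA Bx.
pose up (s : seq X) := [set s' : seq X | {subset s <= s'}].
pose F : set_system (seq X) := filter_from setT up.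
have FF : Filter F.
  apply: filter_from_filter; first by exists [::].
  move=> s s' _ _; exists (s ++ s') => // t ss't; split=> x xs; apply: ss't.
    by rewrite mem_cat xs.
  by rewrite mem_cat xs orbT.
have [x Ax|s _ sP] := cA _ F (fun s x => exists2 y, y \in s & B y x) FF.
  exists (B x, up [:: x]); first by split => /=; [exact: Bx|exists [:: x]].
  by move=> [y s] /= [By sx]; exists x => //; apply: sx; rewrite mem_head.
by exists s => x Ax; apply: (sP s) => //; move=> y.
Qed.

Section Uniformity.
Variables (R : realType) (n : nat) (X : topologicalType) (M : smooth_manifold R n X)
  (G : riemannian_metric M).
Local Notation E := 'rV[R]_n.

(** Charts are cut down to closed coordinate balls: compactness makes estimates uniform on each, and
    closedness lets [uniformize] discard orbits that end outside a given [B j]. *)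
Lemma finite_atlas : compact [set: X] ->
  exists (I : finType) (cc : I -> chart R n X) (B : I -> set X),
    (forall i, [/\ atlas M (cc i), compact (B i), closed (B i) & B i `<=` chart_dom (cc i)]) /\
    forall x, exists i, B i x.
Proof.
move=> cX.
have /choice[r rP] x : exists r : R, 0 < r /\
    closed (chart_cball (chart_at M x) (chart_at M x x) r).
  have [r r0 [rimg _]] := near_chart_cball (chart_at_dom M x) (@filterT _ (nbhs x) _).
  by exists r; split => //; exact: chart_cball_closed.
pose B x := chart_cball (chart_at M x) (chart_at M x x) (r x).
have [s sP] : exists s : seq X, forall x, [set: X] x -> exists2 y, y \in s & B y x.
  apply: (compact_finite_cover cX) => x _.
  exact: chart_cball_nbhs (rP x).1 (chart_at_dom M x).
exists (seq_sub s), (fun i => chart_at M (ssval i)), (fun i => B (ssval i)); split=> [i|x].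
  split; first exact: chart_at_atlas.
  - by apply: (subclosed_compact (rP _).2 cX).
  - exact: (rP _).2.
  - by move=> y [].
by have [y ys By] := sP x I; exists (SeqSub ys).
Qed.

Section Chains.
Variable f : X -> X.
Hypothesis cf : continuous f.

Definition chain (t : R) (k : nat) (x y : X) :=
  iter k (sv_image (perturbation G f t)) [set x] y.

Lemma rball_le x (s t : R) : s <= t -> rball G x s `<=` rball G x t.
Proof. by move=> st y /lt_le_trans; apply; rewrite lee_fin. Qed.

(** For a fixed number of steps, pseudo-orbits approach orbits as the jumps shrink, uniformly near
    the starting point. The induction removes the last step, where [rball_near] bounds the jump for
    all centers near the orbit. *)
Lemma chain_near k x S : nbhs (iter k f x) S ->
  exists2 S0, nbhs x S0 & \forall t \near (0 : R)^'+,
    forall y z, S0 y -> chain t k y z -> S z.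
Proof.
elim: k S => [|k IHk] S xS.
  by exists S => //; apply: nearW => t y z Sy /= ->.
have [e e0 eS] := rball_near G xS.
have [S0 S0x tP] := IHk _ (cf eS).
exists S0 => //; have te : \forall t \near (0 : R)^'+, t <= e by exact: nbhs_right_le.
apply: filterS2 tP te => t tP te y z S0y [w yw wz].
exact: (tP y w S0y yw z (rball_le te wz)).
Qed.

Variables (I : finType) (B : I -> set X).
Hypotheses (cB : forall i, compact (B i)) (clB : forall i, closed (B i)).

(** Short-jump pseudo-orbits starting near [x] end near [iter k f x], so a property known near such
    pairs passes to them, and compactness of [B i] gives one threshold for [t]. If [iter k f x] is
    not in the closed set [B j], no such pseudo-orbit ends in [B j]. *)
Lemma uniformize k (Q : R -> I -> I -> X -> X -> Prop) :
  (forall i j x, B i x -> B j (iter k f x) -> exists S S', [/\ nbhs x S,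
     nbhs (iter k f x) S' & \forall t \near (0 : R)^'+,
       forall y z, S y -> S' z -> B i y -> B j z -> Q t i j y z]) ->
  \forall t \near (0 : R)^'+, forall i j y z, B i y -> B j z -> chain t k y z ->
    Q t i j y z.
Proof.
move=> loc.
have FF : Filter (0 : R)^'+ by exact: at_right_proper_filter.
apply: (@filter_forall _ _ (fun i t => forall j y z, B i y -> B j z -> chain t k y z ->
    Q t i j y z)) => i.
apply: (@filter_forall _ _ (fun j t => forall y z, B i y -> B j z -> chain t k y z ->
    Q t i j y z)) => j.
suff : \forall t \near (0 : R)^'+, forall y, B i y ->
    forall z, B j z -> chain t k y z -> Q t i j y z.
  by apply: filterS => t tP y z By; exact: tP.
apply: near_uniform => // x Bx.
have [Bjx|nBjx] := pselect (B j (iter k f x)).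
  have [S [S' [xS xS' tP]]] := loc i j x Bx Bjx.
  have [S0 xS0 tP0] := chain_near xS'.
  exists (S `&` S0); first exact: filterI.
  by apply: filterS2 tP tP0 => t tP tP0 y [Sy S0y] By z Bz yz; apply: tP => //; exact: tP0 yz.
have xS' : nbhs (iter k f x) (~` B j).
  by apply: open_nbhs_nbhs; split => //; exact: closed_openC.
have [S0 xS0 tP0] := chain_near xS'.
exists S0 => //; apply: filterS tP0 => t tP0 y S0y _ z Bz yz.
by case: (tP0 y z S0y yz).
Qed.

End Chains.
End Uniformity.

(** * Local estimates *)

Lemma opb_near (R : realType) n (T : Type) (F : set_system T) (FF : Filter F)
    (A : T -> 'M[R]_n) (A0 : 'M[R]_n) (a b : R) :
  A @ F --> A0 -> opb A0 a -> a < b -> \forall t \near F, opb (A t) b.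
Proof.
move=> /cvgrPdist_le AA0 A0a ab; have e0 : 0 < (b - a) / n.+1%:R.
  by rewrite divr_gt0// subr_gt0.
apply: filterS (AA0 _ e0) => t At v.
have -> : v *m A t = v *m A0 - v *m (A0 - A t) by rewrite mulmxBr subKr.
rewrite (le_trans (ler_normB _ _))// -[b](subrKC a) mulrDl lerD// (le_trans (opbP _ _))//.
rewrite ler_wpM2r// (le_trans (ler_wpM2l _ At))// mulrCA ler_piMr ?subr_ge0 ?(ltW ab)//.
by rewrite ler_pdivrMr// mul1r ler_nat.
Qed.

Section LocalEstimates.
Variables (R : realType) (n : nat) (X : topologicalType) (M : smooth_manifold R n X)
  (G : riemannian_metric M).
Local Notation E := 'rV[R]_n.
Local Notation mat := 'M[R]_n.
Variables (Es Eu : X -> {vspace E}).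
Hypothesis split : forall x, (Es x + Eu x = fullv)%VS /\ (Es x :&: Eu x = 0)%VS.
Hypotheses (cEs : continuous_subbundle M Es) (cEu : continuous_subbundle M Eu).
Local Notation P := (split_mx M Es Eu).

Lemma approx_linear_near (F : E -> E) (c : chart R n X) x (A : mat) (eta : R) : chart_dom c x ->
  0 < eta -> sdiff F (c x) A -> exists2 S, nbhs x S &
    \forall t \near (0 : R)^'+, forall y, S y -> approx_linear F (c y) t A eta.
Proof.
move=> cx eta0 /(_ eta eta0)[r r0 FA]; have r20 : 0 < r / 2 by rewrite divr_gt0.
exists (chart_cball c (c x) (r / 2)); first exact: chart_cball_nbhs.
have tr : \forall t \near (0 : R)^'+, t <= r / 2 by exact: nbhs_right_le.
apply: filterS tr => t tr y [_ yr] v w vy wy.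
by apply: FA; [have := ler_distD (c y) v (c x)|have := ler_distD (c y) w (c x)]; lra.
Qed.

Section OneMap.
Variables (h h' : X -> X) (c d : chart R n X) (x : X).
Hypotheses (hK : cancel h h')
  (sh : forall y, sdiff_at M h y) (sh' : forall y, sdiff_at M h' y)
  (Mc : atlas M c) (Md : atlas M d) (cx : chart_dom c x) (dx : chart_dom d (h x)).
Local Notation D := (jac (rep c h d) (c x)).
Local Notation D' := (jac (rep d h' c) (d (h x))).

Lemma jac_cancel : D *m D' = 1%:M.
Proof.
have cx' : chart_dom c (h' (h x)) by rewrite hK.
rewrite -(jac_rep_comp (sh x) (sh' (h x)) Mc Md Mc cx dx cx') (_ : h' \o h = id).
  exact: (jac_rep_id Mc cx).
by apply/funext => y; exact: hK.
Qed.

(** At [(x, h x)] the two contracted blocks are bounded by 1/16 and the off-diagonal ones vanish;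
    the bounds asked for are larger, so they persist nearby. The Jacobians stay frozen at [x] and
    [h x], and only the projections move, with [y] and [z] independent. *)
Lemma hyp_lin_near (K : R) : 1 <= K ->
  stable M h Es -> stable M h Eu -> stable M h' Es -> stable M h' Eu ->
  opb (P c x *m D) (1/16) -> opb ((1%:M - P d (h x)) *m D') (1/16) ->
  exists S S', [/\ nbhs x S, nbhs (h x) S' & \forall t \near (0 : R)^'+,
    forall y z, S y -> S' z ->
      hyp_lin K t (c y) (P c y) (d z) (P d z) (rep c h d) (rep d h' c)].
Proof.
move=> K1 hS hU hS' hU' PD QD.
have cx' : chart_dom c (h' (h x)) by rewrite hK.
pose L : R := n%:R * `|D|; have L0 : 0 <= L by rewrite mulr_ge0.
(* The first bound gives [8 * K ^+ 2 * eta <= 1], the second [L * (kappa + K * eta + eta) < 1] with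
   the choice [kappa = eta]; [L + 1] is positive even if [L] is 0. *)
pose eta : R := minr (1 / (8 * K ^+ 2)) (1 / (2 * (L + 1) * (K + 2))).
have K0 : 0 < K by lra.
have K2 : 0 < K ^+ 2 by rewrite exprn_gt0.
have eta0 : 0 < eta by rewrite lt_min !divr_gt0// !mulr_gt0//; lra.
have eta1 : 8 * K ^+ 2 * eta <= 1.
  by rewrite mulrC -ler_pdivlMr; [rewrite /eta ge_min lexx|rewrite mulr_gt0].
have eta2 : L * (eta + K * eta + eta) < 1.
  have : 2 * (L + 1) * (K + 2) * eta <= 1.
    rewrite mulrC -ler_pdivlMr; first by rewrite /eta ge_min lexx orbT.
    by rewrite !mulr_gt0//; lra.
  have : 0 < (L + 1) * (K + 2) * eta by rewrite !mulr_gt0//; lra.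
  have : 0 < (K + 2) * eta by rewrite mulr_gt0//; lra.
  nra.
have [S1 xS1 t1] := approx_linear_near cx eta0 ((sh x).2 c d Mc Md cx dx).
have [S2 xS2 t2] := approx_linear_near dx eta0 ((sh' (h x)).2 d c Md Mc dx cx').
pose FF := filter_prod (nbhs x) (nbhs (h x)).
have FFF : Filter FF by exact: filter_prod_filter.
have cP : (fun yz : X * X => P c yz.1) @ FF --> P c x.
  by apply: (cvg_comp _ _ (@cvg_fst _ _ (nbhs x) (nbhs (h x)) _)); exact: split_mx_continuous.
have cP' : (fun yz : X * X => P d yz.2) @ FF --> P d (h x).
  by apply: (cvg_comp _ _ (@cvg_snd _ _ (nbhs x) (nbhs (h x)) _)); exact: split_mx_continuous.
have cst (A : mat) : (fun=> A) @ FF --> A by exact: cvg_cst.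
have cQ : (fun yz : X * X => 1%:M - P c yz.1) @ FF --> 1%:M - P c x.
  exact: cvgB (cst 1%:M) cP.
have cQ' : (fun yz : X * X => 1%:M - P d yz.2) @ FF --> 1%:M - P d (h x).
  exact: cvgB (cst 1%:M) cP'.
have opb0 : opb (0 : mat) 0 by move=> v; rewrite mulmx0 normr0 mul0r.
have lt8 : 1 / 16 < 1 / 8 :> R by lra.
have gt8 : 0 < 1 / 8 :> R by lra.
have M1 := cvg_mulmx FFF (cvg_mulmx FFF cP (cst D)) cP'.
rewrite (stable_mulS split (sh x) Mc Md cx dx hS) in M1.
have M2 := cvg_mulmx FFF (cvg_mulmx FFF cQ (cst D)) cP'.
rewrite (stable_mulU split (sh x) Mc Md cx dx hU) in M2.
have M3 := cvg_mulmx FFF (cvg_mulmx FFF cQ' (cst D')) cQ.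
have e3 := stable_mulUU split (sh' (h x)) Md Mc dx cx' hU'.
have M4 := cvg_mulmx FFF (cvg_mulmx FFF cP' (cst D')) cQ.
have e4 := stable_mulSU split (sh' (h x)) Md Mc dx cx' hS'.
have M5 := cvg_mulmx FFF (cvg_mulmx FFF cQ' (cst D')) cP.
have e5 := stable_mulU split (sh' (h x)) Md Mc dx cx' hU'.
rewrite hK in e3 e4 e5; rewrite e3 in M3; rewrite e4 in M4; rewrite e5 in M5.
have N1 := opb_near FFF M1 PD lt8; have N2 := opb_near FFF M2 opb0 gt8.
have N3 := opb_near FFF M3 QD lt8; have N4 := opb_near FFF M4 opb0 gt8.
have N5 := opb_near FFF M5 opb0 eta0.
have [[S S'] /= [xS xS'] SS'] := filterI (filterI N1 N2) (filterI (filterI N3 N4) N5).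
exists (S1 `&` S), (S2 `&` S'); split; [exact: filterI|exact: filterI|].
apply: filterS2 t1 t2 => t t1 t2 y z [S1y Sy] [S2z S'z].
have [/= [n1 n2] [[n3 n4] n5]] := SS' (y, z) (conj Sy S'z).
exists D, D', eta, eta, L; split => //.
- by split; [exact: t1|exact: t2].
- by split => //; apply: mulmx1C; exact: jac_cancel.
by split => //; exact: opbP.
Qed.

(** The last clause lets an orbit found in coordinates be read back in [X]: it places the image in
    the domain of the next chart. *)
Lemma shadow_domain_near (rho : R) : 0 < rho ->
  exists S S', [/\ nbhs x S, nbhs (h x) S' & \forall t \near (0 : R)^'+,
    forall y z, S y -> S' z -> forall v, `|v - c y| <= t ->
      [/\ `|rep c h d v - d z| <= rho, rep d h' c (rep c h d v) = v &
          chart_dom d (h (chart_inv c v))]].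
Proof.
move=> rho0; have rho20 : 0 < rho / 2 by rewrite divr_gt0.
have cF : {for c x, continuous (rep c h d)}.
  exact: sdiff_continuous ((sh x).2 c d Mc Md cx dx).
have Fx : rep c h d (c x) = d (h x) by rewrite /rep /= chart_mapK.
have /nbhs_norm_le[r r0 rP] : \forall v \near c x,
    (chart_img c v /\ `|rep c h d v - d (h x)| <= rho / 2) /\
    chart_dom d (h (chart_inv c v)).
  apply: filterI; last exact: (near_chart_inv cx ((sh x).1 _ (near_chart_dom dx))).
  apply: filterI; first exact: near_chart_img.
  by have /cvgrPdistC_le/(_ _ rho20) := cF; rewrite Fx.
have r20 : 0 < r / 2 by rewrite divr_gt0.
exists (chart_cball c (c x) (r / 2)), (chart_cball d (d (h x)) (rho / 2)).
split; [exact: chart_cball_nbhs|exact: chart_cball_nbhs|].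
have tr : \forall t \near (0 : R)^'+, t <= r / 2 by exact: nbhs_right_le.
apply: filterS tr => t tr y z [_ yr] [_ zr] v vt.
have [|[vc vd] dv] := rP v; first by have := ler_distD (c y) v (c x); lra.
split => //.
  have := ler_distD (d (h x)) (rep c h d v) (d z); rewrite [`|d (h x) - _|]distrC; lra.
by rewrite /rep /= chart_mapK// hK chart_invK.
Qed.

Lemma jump_near (e : R) : 0 < e ->
  exists S S', [/\ nbhs x S, nbhs (h x) S' & forall y z, S y -> S' z ->
      `|rep c h d (c y) - d z| <= e /\ `|rep d h' c (d z) - c y| <= e].
Proof.
move=> e0; have e20 : 0 < e / 2 by rewrite divr_gt0.
have cx' : chart_dom c (h' (h x)) by rewrite hK.
have cF : {for c x, continuous (rep c h d)}.
  exact: sdiff_continuous ((sh x).2 c d Mc Md cx dx).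
have cG : {for d (h x), continuous (rep d h' c)}.
  exact: sdiff_continuous ((sh' (h x)).2 d c Md Mc dx cx').
have Fx : rep c h d (c x) = d (h x) by rewrite /rep /= chart_mapK.
have Gx : rep d h' c (d (h x)) = c x by rewrite /rep /= chart_mapK// hK.
have nF : \forall v \near c x, `|rep c h d v - d (h x)| <= e / 2.
  by have /cvgrPdistC_le/(_ _ e20) := cF; rewrite Fx.
have nG : \forall v \near d (h x), `|rep d h' c v - c x| <= e / 2.
  by have /cvgrPdistC_le/(_ _ e20) := cG; rewrite Gx.
exists (chart_cball c (c x) (e / 2) `&` [set y | `|rep c h d (c y) - d (h x)| <= e / 2]).
exists (chart_cball d (d (h x)) (e / 2) `&` [set z | `|rep d h' c (d z) - c x| <= e / 2]).
split.
- by apply: filterI; [exact: chart_cball_nbhs|exact: (near_chart_map cx nF)].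
- by apply: filterI; [exact: chart_cball_nbhs|exact: (near_chart_map dx nG)].
move=> y z [[_ yr] /= yF] [[_ zr] /= zG]; split.
  have := ler_distD (d (h x)) (rep c h d (c y)) (d z); rewrite [`|d (h x) - _|]distrC; lra.
have := ler_distD (c x) (rep d h' c (d z)) (c y); rewrite [`|c x - _|]distrC; lra.
Qed.

End OneMap.

Variables (I : finType) (cc : I -> chart R n X) (B : I -> set X).
Hypothesis ccB : forall i,
  [/\ atlas M (cc i), compact (B i), closed (B i) & B i `<=` chart_dom (cc i)].

(** Turns closeness in coordinates into membership in an open set. The radius [t] comes before the
    neighbourhood of [x], since the shadowing radius is fixed before transitivity is applied. *)
Lemma chart_ball_near (x : X) (S : set X) : nbhs x S ->
  \forall t \near (0 : R)^'+, \forall y \near x, forall i, B i y ->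
    forall w, `|w - cc i y| <= t -> S (chart_inv (cc i) w).
Proof.
move=> xS.
suff H i : \forall t \near (0 : R)^'+, \forall y \near x, B i y ->
    forall w, `|w - cc i y| <= t -> S (chart_inv (cc i) w).
  have FF : Filter (0 : R)^'+ by exact: at_right_proper_filter.
  have := @filter_forall _ _ (fun i t => \forall y \near x, B i y ->
    forall w, `|w - cc i y| <= t -> S (chart_inv (cc i) w)) _ FF H.
  by apply: filterS => t; exact: (@filter_forall _ _ _ _ (nbhs_filter x)).
have [Mi _ clB Bdom] := ccB i.
have [Bx|nBx] := pselect (B i x); last first.
  apply: nearW => t; have : nbhs x (~` B i).
    by apply: open_nbhs_nbhs; split => //; exact: closed_openC.
  by apply: filterS => y nBy By.
have ix := Bdom _ Bx.
have /nbhs_norm_le[r r0 rP] := near_chart_inv ix xS.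
have r20 : 0 < r / 2 by rewrite divr_gt0.
have tr : \forall t \near (0 : R)^'+, t <= r / 2 by exact: nbhs_right_le.
apply: filterS tr => t tr; apply: filterS (chart_cball_nbhs r20 ix) => y [_ yr] _ w wt.
by apply: rP; have := ler_distD (cc i y) w (cc i x); lra.
Qed.

(** All four bounds persist when [K] grows, so [near_uniform] applies with the filter of
    neighbourhoods of infinity. *)
Lemma uniform_bounds : exists2 K : R, 1 <= K & forall i x, B i x ->
  [/\ forall v : E, `|v *m tcoord_mx M (cc i) x| <= K * tnorm G (x, v),
      forall v : E, tnorm G (x, v) <= K * `|v *m tcoord_mx M (cc i) x|,
      opb (P (cc i) x) K & opb (1%:M - P (cc i) x) K].
Proof.
pose Q (K : R) i x := [/\ forall v : E, `|v *m tcoord_mx M (cc i) x| <= K * tnorm G (x, v),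
      forall v : E, tnorm G (x, v) <= K * `|v *m tcoord_mx M (cc i) x|,
      opb (P (cc i) x) K & opb (1%:M - P (cc i) x) K].
suff H : \forall K \near +oo_R, forall i x, B i x -> Q K i x.
  have K1 : \forall K \near +oo_R, 1 <= K by apply: nbhs_pinfty_ge; exact: num_real.
  by have [K [K1' KP]] := @filter_ex _ (pinfty_nbhs R) _ _ (filterI K1 H); exists K.
apply: (@filter_forall _ _ (fun i K => forall x, B i x -> Q K i x)) => i.
have [Mi cB clB Bdom] := ccB i; apply: near_uniform => // x Bx.
have ix := Bdom _ Bx.
have [K0 K00 KP] := tnorm_chart_equiv G Mi ix.
have cP := split_mx_continuous split Mi ix cEs cEu.
have P1 : n%:R * `|P (cc i) x| < n%:R * `|P (cc i) x| + 1 by rewrite ltrDl.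
have nP := opb_near (nbhs_filter x) cP (opbP _) P1.
exists [set y | (forall v : E, `|v *m tcoord_mx M (cc i) y| <= K0 * tnorm G (y, v) /\
    tnorm G (y, v) <= K0 * `|v *m tcoord_mx M (cc i) y|) /\
    opb (P (cc i) y) (n%:R * `|P (cc i) x| + 1)]; first exact: filterI.
have K1 : \forall K \near +oo_R, K0 <= K by apply: nbhs_pinfty_ge; exact: num_real.
(* One unit for the variation of [P] around [x], another because [1 - P] exceeds the bound of [P] by
   at most 1. *)
have K2 : \forall K \near +oo_R, n%:R * `|P (cc i) x| + 2 <= K.
  by apply: nbhs_pinfty_ge; exact: num_real.
apply: filterS2 K1 K2 => K K1 K2 y [yK yP] _; split => v.
- by rewrite (le_trans (yK v).1)// ler_wpM2r// sqrtr_ge0.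
- by rewrite (le_trans (yK v).2)// ler_wpM2r.
- by rewrite (le_trans (yP v))// ler_wpM2r//; lra.
rewrite mulmxBr mulmx1 (le_trans (ler_normB _ _))//.
have := yP v; have := ler_wpM2r (normr_ge0 v) K2.
rewrite !mulrDl mul1r; lra.
Qed.

End LocalEstimates.

(** * Transitivity *)

Lemma iter_cancel (T : Type) (f g : T -> T) k : cancel f g -> cancel (iter k f) (iter k g).
Proof. by move=> fg; elim: k => [//|k IHk] x; rewrite iterSr /= fg IHk. Qed.

Lemma iter_continuous (X : topologicalType) (f : X -> X) k :
  continuous f -> continuous (iter k f).
Proof.
move=> cf; elim: k => [|k IHk] x; first exact: cvg_id.
by apply: (continuous_comp (IHk x)); exact: cf.
Qed.

Lemma exists_expr_lt (R : realType) (lam e : R) : 0 < lam < 1 -> 0 < e ->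
  exists2 N, (0 < N)%N & lam ^+ N <= e.
Proof.
move=> /andP[l0 l1] e0.
have /cvgrPdist_le/(_ e e0) : lam ^+ N @[N --> \oo] --> (0 : R).
  by apply: cvg_expr; rewrite gtr0_norm.
move=> [N _ NP]; exists N.+1 => //.
have := NP N.+1 (leqnSn N); rewrite sub0r normrN ger0_norm// exprn_ge0// ltW//.
Qed.

Section PseudoOrbits.
Variables (R : realType) (n : nat) (X : topologicalType) (M : smooth_manifold R n X)
  (G : riemannian_metric M) (f : X -> X).

Lemma rball_refl (x : X) (e : R) : 0 < e -> rball G x e x.
Proof.
move=> e0; rewrite /rball /rdist /=.
apply: (@le_lt_trans _ _ 0%:E); last by rewrite lte_fin.
by apply: ereal_inf_lbound; exists 0 => //; exact: joined_nil.
Qed.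

(** Following the true orbit of [z] after time [k] adds no jump, so the sequence is a pseudo-orbit
    at all times and can be cut at any later one. *)
Lemma sv_orbit (e : R) (A : set X) k z : 0 < e ->
  iter k (sv_image (perturbation G f e)) A z ->
  exists x : nat -> X, [/\ A (x 0%N), forall i, rball G (f (x i)) e (x i.+1) &
    forall j, x (k + j)%N = iter j f z].
Proof.
move=> e0; elim: k z => [|k IHk] z.
  by move=> /= Az; exists (fun i => iter i f z); split => // i; exact: rball_refl.
move=> [w /IHk[x [Ax xs xk]] wz].
exists (fun i => if (i <= k)%N then x i else iter (i - k.+1) f z); split => [//|i|j].
- case: (ltngtP i k) => [ik|ki|->]; first exact: xs.
    by rewrite subSn//; exact: rball_refl.
  by rewrite subnn /=; have := xk 0%N; rewrite addn0 => ->.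
by rewrite addSn leqNgt ltnS leq_addr /= subSS addnC addnK.
Qed.

Lemma chain_orbit (e : R) (x : nat -> X) a m :
  (forall i, rball G (f (x i)) e (x i.+1)) -> chain G f e m (x a) (x (a + m)%N).
Proof.
move=> xs; elim: m => [|m IHm]; first by rewrite addn0.
by exists (x (a + m)%N) => //; rewrite addnS; exact: xs.
Qed.

Lemma chain_le (s t : R) m x y : s <= t -> chain G f s m x y -> chain G f t m x y.
Proof.
move=> st; elim: m y => [//|m IHm] y [w xw wy].
by exists w; [exact: IHm|exact: rball_le st _ wy].
Qed.

End PseudoOrbits.

Theorem theoremA (R : realType) (n : nat) (X : topologicalType)
    (M : smooth_manifold R n X) (G : riemannian_metric M)
    (hcompact : compact [set: X]) (hconnected : connected [set: X])
    (f : X -> X) (hf : anosov G f) :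
  (forall e : R, 0 < e -> sv_transitive (perturbation G f e)) ->
  topologically_transitive f.
Proof.
move=> trans U V oU oV [u0 Uu0] [v0 Vv0].
have [g [[fg gf C1f C1g] [Es [Eu [split [cEs cEu] [iEs iEu]
  [C [lam [C0 lam01 cS cU]]]]]]]] := hf.
have sf := Ck1_sdiff_at C1f; have sg := Ck1_sdiff_at C1g.
have cf : continuous f := C1f.1; have cg : continuous g := C1g.1.
have [I [cc [B [ccB cov]]]] := finite_atlas M hcompact.
have /choice[idx idxP] := cov.
have [K K1 KP] := uniform_bounds G split cEs cEu ccB.
have K0 : 0 < K by lra.
have K30 : 0 < K ^+ 3 by rewrite exprn_gt0.
(* The contraction [C * lam ^+ N] must beat the distortion [K ^+ 3] of the charts and leave 1/16,
   the bound required by [hyp_lin_near]. *)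
have [||N N0 lamN] := @exists_expr_lt R lam (1 / 16 / (K ^+ 3 * C)) => //.
  by rewrite !divr_gt0// mulr_gt0.
pose l := C * lam ^+ N.
have l0 : 0 <= l by rewrite mulr_ge0 ?exprn_ge0//; [exact: ltW|case/andP: lam01 => /ltW].
have Kl : K ^+ 3 * l <= 1 / 16.
  by rewrite mulrA mulrC -ler_pdivlMr// mulr_gt0.
pose h := iter N f; pose h' := iter N g.
have hK : cancel h h' by exact: iter_cancel.
have sh x : sdiff_at M h x by exact: sdiff_at_iter.
have sh' x : sdiff_at M h' x by exact: sdiff_at_iter.
have hS : stable M h Es by apply: stable_iter => //; exact: invariant_stable.
have hU : stable M h Eu by apply: stable_iter => //; exact: invariant_stable.
have hS' : stable M h' Es.
  by apply: stable_iter => //; exact: (invariant_stable_inv fg gf sf sg iEs).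
have hU' : stable M h' Eu.
  by apply: stable_iter => //; exact: (invariant_stable_inv fg gf sf sg iEu).
pose P i := split_mx M Es Eu (cc i).
have ccM i : atlas M (cc i) by case: (ccB i).
have ccD i x : B i x -> chart_dom (cc i) x by case: (ccB i) => _ _ _; exact.
have cB i : compact (B i) by case: (ccB i).
have clB i : closed (B i) by case: (ccB i).
have FF : ProperFilter (0 : R)^'+ by exact: at_right_proper_filter.
have contrS x (s : 'rV[R]_n) : s \in Es x ->
    tnorm G (h x, s *m tangent_mx M h x) <= l * tnorm G (x, s).
  by move=> sE; have := cS x s N sE; rewrite iter_tangent_map.
have contrU x (s : 'rV[R]_n) : s \in Eu x ->
    tnorm G (h' x, s *m tangent_mx M h' x) <= l * tnorm G (x, s).
  by move=> sE; have := cU x s N sE; rewrite iter_tangent_map.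
have lin := @uniformize _ _ _ _ G f cf I B cB clB N (fun t i j y z =>
  hyp_lin K t (cc i y) (P i y) (cc j z) (P j z) (rep (cc i) h (cc j)) (rep (cc j) h' (cc i))).
have {}lin : \forall t \near (0 : R)^'+, forall i j y z, B i y -> B j z ->
    chain G f t N y z -> hyp_lin K t (cc i y) (P i y) (cc j z) (P j z)
      (rep (cc i) h (cc j)) (rep (cc j) h' (cc i)).
  apply: lin => i j x Bx Bhx.
  have ix := ccD _ _ Bx; have jx := ccD _ _ Bhx.
  have [Kx1 Kx2 Kx3 Kx4] := KP _ _ Bx; have [Ky1 Ky2 Ky3 Ky4] := KP _ _ Bhx.
  have PD : opb (P i x *m jac (rep (cc i) h (cc j)) (cc i x)) (1/16).
    apply: opbW Kl _; apply: (contracted_opb (F := Es) (sh x) (ccM i) (ccM j) ix jx) => //.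
    - exact: ltW.
    - by move=> w; exact: split_mx_im.
    - exact: contrS.
  have QD : opb ((1%:M - P j (h x)) *m jac (rep (cc j) h' (cc i)) (cc j (h x))) (1/16).
    have ix' : chart_dom (cc i) (h' (h x)) by rewrite hK.
    apply: opbW Kl _.
    apply: (contracted_opb (F := Eu) (sh' (h x)) (ccM j) (ccM i) jx ix') => //.
    - exact: ltW.
    - by move=> w; exact: split_mx_ker.
    - exact: contrU.
    - by rewrite hK.
  have [S [S' [xS xS' tP]]] := hyp_lin_near split cEs cEu hK sh sh' (ccM i) (ccM j)
    ix jx K1 hS hU hS' hU' PD QD.
  exists S, S'; split => //; apply: filterS tP => t tP y z Sy Sz _ _; exact: tP.
have pos : \forall t \near (0 : R)^'+, 0 < t by exact: nbhs_right_gt.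
have [rho [rholin rho0]] := @filter_ex _ _ FF _ (filterI lin pos).
have dom : \forall t \near (0 : R)^'+, forall i j y z, B i y -> B j z ->
    chain G f t N y z -> forall v, `|v - cc i y| <= t ->
      [/\ `|rep (cc i) h (cc j) v - cc j z| <= rho,
          rep (cc j) h' (cc i) (rep (cc i) h (cc j) v) = v &
          chart_dom (cc j) (h (chart_inv (cc i) v))].
  apply: (@uniformize _ _ _ _ G f cf I B cB clB N (fun t i j y z => forall v, `|v - cc i y| <= t ->
      [/\ `|rep (cc i) h (cc j) v - cc j z| <= rho,
          rep (cc j) h' (cc i) (rep (cc i) h (cc j) v) = v &
          chart_dom (cc j) (h (chart_inv (cc i) v))])) => i j x Bx Bhx.
  have [S [S' [xS xS' tP]]] := shadow_domain_near hK sh (ccM i) (ccM j)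
    (ccD _ _ Bx) (ccD _ _ Bhx) rho0.
  by exists S, S'; split => //; apply: filterS tP => t tP y z Sy Sz _ _; exact: tP.
have endU := chart_ball_near ccB (open_nbhs_nbhs (conj oU Uu0)).
(* Closeness to the pseudo-orbit will be known at a multiple of [N], up to [N] steps after the visit
   to [V]; hence the preimages of [V] under [iter j g]. *)
have endV (j : 'I_N.+1) : \forall t \near (0 : R)^'+, \forall y \near iter j f v0,
    forall i, B i y -> forall w, `|w - cc i y| <= t -> V (iter j g (chart_inv (cc i) w)).
  apply: (chart_ball_near ccB (S := iter j g @^-1` V)).
  have nVj : nbhs (iter j g (iter j f v0)) V.
    by rewrite (iter_cancel j fg); exact: open_nbhs_nbhs.
  exact: (@iter_continuous _ g j cg (iter j f v0) V nVj).
have {}endV := filter_forall FF endV.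
have ler : \forall t \near (0 : R)^'+, t <= rho by exact: nbhs_right_le.
have [r [[rdom rU] [rV [r0 rrho]]]] := @filter_ex _ _ FF _
  (filterI (filterI dom endU) (filterI endV (filterI pos ler))).
pose e := r / (4 * K ^+ 2).
have K20 : 0 < 4 * K ^+ 2 by rewrite mulr_gt0// exprn_gt0.
have e0 : 0 < e by rewrite divr_gt0.
have Ke : 4 * K ^+ 2 * e <= r by rewrite mulrC divfK// gt_eqF.
have jump : \forall t \near (0 : R)^'+, forall i j y z, B i y -> B j z ->
    chain G f t N y z -> `|rep (cc i) h (cc j) (cc i y) - cc j z| <= e /\
      `|rep (cc j) h' (cc i) (cc j z) - cc i y| <= e.
  apply: (@uniformize _ _ _ _ G f cf I B cB clB N (fun t i j y z =>
      `|rep (cc i) h (cc j) (cc i y) - cc j z| <= e /\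
      `|rep (cc j) h' (cc i) (cc j z) - cc i y| <= e)) => i j x Bx Bhx.
  have [S [S' [xS xS' tP]]] := jump_near hK sh sh' (ccM i) (ccM j)
    (ccD _ _ Bx) (ccD _ _ Bhx) e0.
  by exists S, S'; split => //; apply: nearW => t y z Sy Sz _ _; exact: tP.
have ledr : \forall t \near (0 : R)^'+, t <= r by exact: nbhs_right_le.
have [d [djump [d0 dr]]] := @filter_ex _ _ FF _ (filterI jump (filterI pos ledr)).
have nV : \forall y \near v0, forall (j : 'I_N.+1) i, B i (iter j f y) ->
    forall w, `|w - cc i (iter j f y)| <= r -> V (iter j g (chart_inv (cc i) w)).
  apply: (@filter_forall _ _ (fun (j : 'I_N.+1) y => forall i, B i (iter j f y) ->
    forall w, `|w - cc i (iter j f y)| <= r -> V (iter j g (chart_inv (cc i) w)))).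
  by move=> j; exact: (@iter_continuous _ f j cf v0 _ (rV j)).
(* Transitivity is applied not to [U] and [V] but to the open sets around [u0] and [v0] where
   [r]-shadowing points are known to land correctly. *)
have [k [k0 [z [zk nVz]]]] := trans d d0 _ _ (open_interior _) (open_interior _)
  (ex_intro _ u0 rU) (ex_intro _ v0 nV).
have {nVz}nVz := interior_subset nVz.
have [x [/interior_subset x0U xstep xk]] := sv_orbit d0 zk.
(* The pseudo-orbit is prolonged by a true orbit up to a multiple of [N]. *)
pose q := (k %/ N).+1; pose j := (q * N - k)%N.
have kq : (k <= q * N)%N by rewrite ltnW// ltn_ceil.
have jN : (j < N.+1)%N by rewrite ltnS leq_subLR mulSn addnC leq_add2r leq_divM.
have qE : (q * N = k + j)%N by rewrite subnKC.
pose Y i := x (i * N)%N; pose c i := cc (idx (Y i)).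
have BY i : B (idx (Y i)) (Y i) by exact: idxP.
(* One step of [h] is [N] steps of [f]. The jump bound is left free above [d], since the estimates
   are used at [rho], [r] and [d]. *)
have chY i t : d <= t -> chain G f t N (Y i) (Y i.+1).
  by move=> dt; apply: chain_le dt _; rewrite /Y mulSn addnC; exact: chain_orbit.
have [v [va vF]] : exists v : nat -> 'rV[R]_n,
    (forall i, (i <= q)%N -> `|v i - c i (Y i)| <= r) /\
    (forall i, (i < q)%N -> rep (c i) h (c i.+1) (v i) = v i.+1).
  apply: (@finite_shadowing R n K rho r e q (fun i => c i (Y i))
    (fun i => P (idx (Y i)) (Y i)) (fun i => rep (c i) h (c i.+1))
    (fun i => rep (c i.+1) h' (c i))) => //.
  - by rewrite r0.
  - move=> i; have [_ _ ? ?] := KP _ _ (BY i); split => //.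
    exact: (split_mx_idem split (ccM _) (ccD _ _ (BY i))).
  move=> i iq; split.
  - by apply: rholin => //; apply: chY; exact: le_trans dr rrho.
  - by move=> w /(rdom _ _ _ _ (BY i) (BY i.+1) (chY i r dr))[].
  - by have [] := djump _ _ _ _ (BY i) (BY i.+1) (chY i d (lexx _)).
  - by have [] := djump _ _ _ _ (BY i) (BY i.+1) (chY i d (lexx _)).
pose y i := chart_inv (c i) (v i).
have yE i : (i <= q)%N -> y i = iter (i * N) f (y 0%N).
  elim: i => [//|i IHi] iq; rewrite mulSn iterD -IHi ?(ltnW iq)//.
  have [_ _ dy] := rdom _ _ _ _ (BY i) (BY i.+1) (chY i r dr) _ (va i (ltnW iq)).
  by rewrite {1}/y -vF// /rep /= chart_mapK.
exists k; split => //; exists (iter k f (y 0%N)); split.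
  by exists (y 0%N) => //; apply: (x0U (idx (Y 0%N))); [exact: BY|exact: va].
have Yq : Y q = iter j f z by rewrite /Y qE xk.
have := nVz (Ordinal jN) (idx (Y q)) _ (v q); rewrite /= -Yq => /(_ (BY q) (va q (leqnn q))).
by rewrite -/(y q) yE// qE addnC iterD (iter_cancel j fg).
Qed.
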